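(* Let $n\ge 2$. (a) If $\mathfrak A_n$ is the non-commutative disc algebra on $n$ generators, then $\operatorname{tsr}(\mathfrak A_n)=\infty$, i.e. $\operatorname{ltsr}(\mathfrak A_n)=\operatorname{rtsr}(\mathfrak A_n)=\infty$. (b) If $\mathfrak S_n$ is a free semigroup algebra on $n$ generators, then $\operatorname{tsr}(\mathfrak S_n)=\infty$, i.e. $\operatorname{ltsr}(\mathfrak S_n)=\operatorname{rtsr}(\mathfrak S_n)=\infty$.
   Context: All Hilbert spaces are complex, infinite dimensional and separable. For a unital Banach algebra $\mathcal A$ and $m\ge1$, $Lg_m(\mathcal A)$ is the set of $(a_1,\dots,a_m)\in\mathcal A^m$ for which there exist $b_1,\dots,b_m\in\mathcal A$ with $\sum_{i=1}^m b_ia_i=1$, and $Rg_m(\mathcal A)$ is the set of $(a_1,\dots,a_m)\in\mathcal A^m$ for which there exist $b_1,\dots,b_m\in\mathcal A$ with $\sum_{i=1}^m a_ib_i=1$. The left topological stable rank $\operatorname{ltsr}(\mathcal A)$ (resp. right topological stable rank $\operatorname{rtsr}(\mathcal A)$) is the least positive integer $m$ for which $Lg_m(\mathcal A)$ (resp. $Rg_m(\mathcal A)$) is norm dense in $\mathcal A^m$, and is $\infty$ if no such $m$ exists. If $\operatorname{ltsr}(\mathcal A)=\operatorname{rtsr}(\mathcal A)$, the common value is denoted $\operatorname{tsr}(\mathcal A)$. The non-commutative disc algebra $\mathfrak A_n$ is the norm-closed subalgebra of $\mathcal B(\mathfrak H)$ generated by the identity operator $I$ and $n$ isometries $S_1,\dots,S_n$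 on a Hilbert space $\mathfrak H$ with pairwise orthogonal ranges (by a theorem of Popescu, its complete isometric isomorphism class is independent of the choice of the isometries). A free semigroup algebra $\mathfrak S_n$ on $n$ generators is the closure in the weak operator topology of such an algebra, i.e. the WOT-closed subalgebra of $\mathcal B(\mathfrak H)$ generated by $I$ and some $n$ isometries $S_1,\dots,S_n\in\mathcal B(\mathfrak H)$ with pairwise orthogonal ranges; it carries the operator norm. *)

(* Defs.v *)
From HB Require Import structures.
From mathcomp Require Import all_boot all_order all_algebra.
From mathcomp Require Import sesquilinear complex.
From mathcomp Require Import all_classical all_reals all_analysis.

Set Implicit Arguments.
Unset Strict Implicit.
Unset Printing Implicit Defensive.

Import Order.TTheory GRing.Theory Num.Theory.
Import numFieldNormedType.Exports.

Local Open Scope classical_set_scope.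
Local Open Scope ring_scope.
Local Open Scope complex_scope.

(** * Unital Banach algebras and topological stable ranks *)

(* The multiplication is a fresh operation because Hierarchy Builder has no
   join of rings and normed modules (the join would have to sit below
   numDomainType). *)
HB.mixin Record CompleteNormedModule_isBanachAlgebra (K : numFieldType) A
    & CompleteNormedModule K A := {
  bone : A;
  bmul : A -> A -> A;
  bmulA : associative bmul;
  bmul1l : left_id bone bmul;
  bmul1r : right_id bone bmul;
  bmulDl : left_distributive bmul +%R;
  bmulDr : right_distributive bmul +%R;
  bmulZl : forall (k : K) x y, bmul (k *: x) y = k *: bmul x y;
  bmulZr : forall (k : K) x y, bmul x (k *: y) = k *: bmul x y;
  ler_norm_bmul : forall x y, `|bmul x y| <= `|x| * `|y| }.

#[short(type="banachAlgType")]
HB.structure Definition BanachAlgebra (K : numFieldType) :=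
  {A of CompleteNormedModule K A & CompleteNormedModule_isBanachAlgebra K A}.

Section StableRank.
Context {K : numFieldType}.
Variable A : banachAlgType K.

(* Row vectors over A carry the product of the norm topologies. *)
Definition Lg (m : nat) : set 'rV[A]_m :=
  [set a | exists b : 'rV[A]_m, \sum_i bmul (b 0 i) (a 0 i) = bone].

Definition Rg (m : nat) : set 'rV[A]_m :=
  [set a | exists b : 'rV[A]_m, \sum_i bmul (a 0 i) (b 0 i) = bone].
Arguments Lg : clear implicits.
Arguments Rg : clear implicits.

(* The least positive m such that P m, and +oo if there is none. *)
Definition least_positive (P : nat -> Prop) : \bar nat :=
  if pselect (exists m, `[< (0 < m)%N /\ P m >]) is left ex
  then (ex_minn ex)%:E else +oo%E.

Definition ltsr : \bar nat := least_positive (fun m => dense (Lg m)).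

Definition rtsr : \bar nat := least_positive (fun m => dense (Rg m)).

End StableRank.

Arguments Lg {K} A m.
Arguments Rg {K} A m.
Arguments ltsr {K} A.
Arguments rtsr {K} A.

(** * Norm-closed unital subalgebras, as Banach algebras *)

Section ClosedSubalgebra.
Context {K : numFieldType} {A : banachAlgType K}.

Definition unital_subalgebra (M : set A) : Prop :=
  [/\ M bone,
      forall x y, M x -> M y -> M (x + y),
      forall (k : K) x, M x -> M (k *: x) &
      forall x y, M x -> M y -> M (bmul x y)].

Record closed_subalgebra := ClosedSubalgebra {
  subalg_set :> set A;
  subalg_unital : unital_subalgebra subalg_set;
  subalg_norm_closed : closed subalg_set }.
Arguments subalg_norm_closed : clear implicits.

(* The smallest unital subalgebra that contains X and satisfies cl, for a closure
   condition cl that is stable under intersections. *)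
Definition unital_subalgebra_generated (cl : set (set A)) (X : set A) : set A :=
  smallest [set M | unital_subalgebra M /\ cl M] X.

Lemma unital_subalgebra_generatedP cl X :
  unital_subalgebra (unital_subalgebra_generated cl X).
Proof.
split=> [M [[[]]]//|x y Mx My M HM|k x Mx M HM|x y Mx My M HM].
- by have [[[_ MD _ _] _] _] := HM; apply: MD; [exact: Mx|exact: My].
- by have [[[_ _ MZ _] _] _] := HM; apply: MZ; exact: Mx.
- by have [[[_ _ _ MM] _] _] := HM; apply: MM; [exact: Mx|exact: My].
Qed.

Variable M : closed_subalgebra.

Definition in_subalg : {pred A} := [pred x | x \in subalg_set M].

Lemma in_subalgP x : reflect (subalg_set M x) (x \in in_subalg).
Proof. by rewrite [x \in in_subalg]inE; apply: (iffP idP); rewrite inE. Qed.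

Record subalg_sort := SubalgSort {
  subalg_val : A;
  subalg_valP : subalg_val \in in_subalg }.

HB.instance Definition _ := [isSub for subalg_val].
HB.instance Definition _ := [Choice of subalg_sort by <:].

Fact subalg_subsemimod_closed : subsemimod_closed in_subalg.
Proof.
have [M1 MD MZ _] := subalg_unital M; split; first split.
- by apply/in_subalgP; rewrite -(scale0r bone); exact: MZ.
- by move=> x y /in_subalgP Mx /in_subalgP My; apply/in_subalgP; exact: MD.
- by move=> k x /in_subalgP Mx; apply/in_subalgP; exact: MZ.
Qed.

HB.instance Definition _ :=
  GRing.SubChoice_isSubLmodule.Build K A in_subalg subalg_sort
    subalg_subsemimod_closed.

Let nrm (x : subalg_sort) : K := `|subalg_val x|.

Let ler_nrmD x y : nrm (x + y) <= nrm x + nrm y.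
Proof. by rewrite /nrm [subalg_val _](raddfD val) ler_normD. Qed.

Let nrmZ (k : K) x : nrm (k *: x) = `|k| * nrm x.
Proof. by rewrite /nrm -normrZ -[RHS]/(`|k *: val x|) -linearZ. Qed.

Let nrm0_eq0 x : nrm x = 0 -> x = 0.
Proof. by move=> /normr0_eq0 x0; apply: val_inj; rewrite raddf0. Qed.

HB.instance Definition _ :=
  @Lmodule_isNormed.Build K subalg_sort nrm ler_nrmD nrmZ nrm0_eq0.

Lemma subalg_normE (x : subalg_sort) : `|x| = `|subalg_val x|.
Proof. by []. Qed.

Let subalg_complete (F : set_system subalg_sort) :
  ProperFilter F -> cauchy F -> cvg F.
Proof.
move=> FF Fc.
have valB (x y : subalg_sort) : subalg_val (x - y) = subalg_val x - subalg_val y.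
  exact: (raddfB val).
have /cauchy_cvg/cvg_ex[l Fl] : cauchy (subalg_val @ F).
  apply/cauchy_ballP => e e0; have /cauchy_ballP/(_ e e0) := Fc.
  case=> -[P Q] /= [FP FQ] PQ.
  exists (subalg_val @` P, subalg_val @` Q).
    split; [apply: filterS FP|apply: filterS FQ]; exact: preimage_image.
  move=> [_ _] [/= [x Px <-] [y Qy <-]]; have := PQ (x, y) (conj Px Qy).
  by rewrite -!ball_normE /= subalg_normE valB.
have Ml : l \in in_subalg.
  apply/in_subalgP; apply: (closed_cvg _ (subalg_norm_closed M) _ l Fl).
  by apply: nearW => x; apply/in_subalgP; exact: subalg_valP.
apply/cvg_ex; exists (SubalgSort Ml); apply/cvgrPdist_lt => e e0.
move/cvgrPdist_lt : Fl => /(_ e e0).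
by apply: filterS => x; rewrite subalg_normE valB.
Qed.

HB.instance Definition _ := Uniform_isComplete.Build subalg_sort subalg_complete.

Fact subalg_one_subproof : bone \in in_subalg.
Proof. by apply/in_subalgP; have [] := subalg_unital M. Qed.

Definition subalg_one := SubalgSort subalg_one_subproof.

Fact subalg_mul_subproof (x y : subalg_sort) :
  bmul (subalg_val x) (subalg_val y) \in in_subalg.
Proof.
have [_ _ _ MM] := subalg_unital M.
by apply/in_subalgP/MM; apply/in_subalgP; exact: subalg_valP.
Qed.

Definition subalg_mul x y := SubalgSort (subalg_mul_subproof x y).

Let mulA : associative subalg_mul.
Proof. by move=> x y z; apply: val_inj; rewrite /= bmulA. Qed.
Let mul1l : left_id subalg_one subalg_mul.
Proof. by move=> x; apply: val_inj; rewrite /= bmul1l. Qed.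
Let mul1r : right_id subalg_one subalg_mul.
Proof. by move=> x; apply: val_inj; rewrite /= bmul1r. Qed.
Let mulDl : left_distributive subalg_mul +%R.
Proof. by move=> x y z; apply: val_inj; rewrite /= bmulDl. Qed.
Let mulDr : right_distributive subalg_mul +%R.
Proof. by move=> x y z; apply: val_inj; rewrite /= bmulDr. Qed.
Let mulZl (k : K) x y : subalg_mul (k *: x) y = k *: subalg_mul x y.
Proof. by apply: val_inj; rewrite /= bmulZl. Qed.
Let mulZr (k : K) x y : subalg_mul x (k *: y) = k *: subalg_mul x y.
Proof. by apply: val_inj; rewrite /= bmulZr. Qed.
Let ler_norm_mul x y : `|subalg_mul x y| <= `|x| * `|y|.
Proof. exact: ler_norm_bmul. Qed.

HB.instance Definition _ :=
  CompleteNormedModule_isBanachAlgebra.Build K subalg_sort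
    mulA mul1l mul1r mulDl mulDr mulZl mulZr ler_norm_mul.

End ClosedSubalgebra.

Arguments closed_subalgebra {K} A.
Arguments subalg_unital {K A}.
Arguments subalg_norm_closed {K A}.

(** * Hilbert spaces *)

(* Throughout, Hilbert spaces are complex, infinite dimensional and separable.
   The inner product is linear in its first argument. *)
HB.mixin Record CompleteNormedModule_isHilbert (R : realType) H
    & CompleteNormedModule R[i] H := {
  inner : {dot H for (@Num.conj R[i])};
  inner_norm : forall x : H, inner x x = `|x| ^+ 2;
  hilbert_infinite_dim : ~ exists s : seq H, forall x : H,
    exists c : nat -> R[i], x = \sum_(i < size s) c i *: s`_i;
  hilbert_separable : exists2 D : set H, countable D & dense D }.

#[short(type="hilbertType")]
HB.structure Definition Hilbert (R : realType) :=
  {H of CompleteNormedModule R[i] H & CompleteNormedModule_isHilbert R H}.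

(** * The Banach algebra of bounded operators on a Hilbert space *)

Section BoundedOperators.
Context {R : realType}.
Variable H : hilbertType R.

Let RRe_norm (V : normedModType R[i]) (x : V) : (complex.Re `|x|)%:C = `|x|.
Proof. exact/RRe_real/ger0_real. Qed.

Let RRe_normC (x : R[i]) : (complex.Re `|x|)%:C = `|x|.
Proof. exact/RRe_real/ger0_real. Qed.

Let realCD (x y : R) : (x + y)%:C = x%:C + y%:C.
Proof. exact: rmorphD. Qed.

Let realCM (x y : R) : (x * y)%:C = x%:C * y%:C.
Proof. exact: rmorphM. Qed.

Definition bounded_linear (f : H -> H) : Prop :=
  linear f /\ exists M : R, forall x, `|f x| <= M%:C * `|x|.

Definition is_bounded_linear : {pred H -> H} := [pred f | `[< bounded_linear f >]].

Lemma is_bounded_linearP f : reflect (bounded_linear f) (f \in is_bounded_linear).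
Proof. exact: asboolP. Qed.

Record bounded_op := BoundedOp {
  op_fun :> H -> H;
  op_funP : op_fun \in is_bounded_linear }.

HB.instance Definition _ := [isSub for op_fun].
HB.instance Definition _ := [Choice of bounded_op by <:].

Fact is_bounded_linear_subsemimod_closed : subsemimod_closed is_bounded_linear.
Proof.
split; first split.
- apply/is_bounded_linearP; split=> [k x y|]; first by rewrite /= scaler0 addr0.
  by exists 0 => x; rewrite normr0 mul0r.
- move=> f g /is_bounded_linearP[lf [M fM]] /is_bounded_linearP[lg [N gN]].
  apply/is_bounded_linearP; split=> [k x y|].
    by rewrite !fctE lf lg scalerDr addrACA.
  exists (M + N) => x; rewrite !fctE realCD mulrDl.
  by rewrite (le_trans (ler_normD _ _))// lerD.
- move=> k f /is_bounded_linearP[lf [M fM]].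
  apply/is_bounded_linearP; split=> [a x y|].
    by rewrite !fctE lf scalerDr !scalerA mulrC.
  exists (complex.Re `|k| * M) => x; rewrite !fctE normrZ realCM -mulrA.
  by rewrite RRe_normC ler_wpM2l.
Qed.

HB.instance Definition _ :=
  GRing.SubChoice_isSubLmodule.Build R[i] (H -> H) is_bounded_linear bounded_op
    is_bounded_linear_subsemimod_closed.

Fact op_linear (T : bounded_op) : linear T.
Proof. by case/is_bounded_linearP: (op_funP T). Qed.

HB.instance Definition _ (T : bounded_op) :=
  GRing.isLinear.Build R[i] H H *:%R T (op_linear T).

(* The norm of H takes its values in the nonnegative reals of R[i], hence the
   real part. *)
Definition op_norm (T : bounded_op) : R :=
  sup [set complex.Re `|T x| | x in [set x : H | `|x| <= 1]].

Lemma op_norm_has_sup (T : bounded_op) :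
  has_sup [set complex.Re `|T x| | x in [set x : H | `|x| <= 1]].
Proof.
have [_ [M TM]] := is_bounded_linearP _ (op_funP T).
split; first by exists (complex.Re `|T 0|), 0 => //=; rewrite normr0.
exists `|M| => _ [x /= x1 <-]; rewrite -lecR RRe_norm (le_trans (TM x))//.
rewrite (@le_trans _ _ (`|M|%:C * `|x|)) ?ler_wpM2r ?lecR ?ler_norm//.
by rewrite ler_piMr ?lecR.
Qed.

Lemma op_norm_ge0 (T : bounded_op) : 0 <= op_norm T.
Proof.
apply: (sup_upper_bound (op_norm_has_sup T)); exists 0; first by rewrite /= normr0.
by rewrite raddf0 normr0.
Qed.

Lemma op_norm_le (T : bounded_op) x : `|T x| <= (op_norm T)%:C * `|x|.
Proof.
have [->|x0] := eqVneq x 0; first by rewrite raddf0 !normr0 mulr0.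
have nx0 : 0 < `|x| by rewrite normr_gt0.
have -> : `|T x| = `|T (`|x|^-1 *: x)| * `|x|.
  by rewrite linearZ/= normrZ normfV normr_id mulrAC mulVf ?mul1r// gt_eqF.
rewrite ler_wpM2r// -RRe_norm lecR.
apply: (sup_upper_bound (op_norm_has_sup T)); exists (`|x|^-1 *: x) => //=.
by rewrite normrZ normfV normr_id mulVf// gt_eqF.
Qed.

Lemma ge_op_norm (T : bounded_op) (M : R) : 0 <= M ->
  (forall x, `|T x| <= M%:C * `|x|) -> op_norm T <= M.
Proof.
move=> M0 TM; apply: ge_sup; first by have [] := op_norm_has_sup T.
move=> _ [x /= x1 <-]; rewrite -lecR RRe_norm (le_trans (TM x))//.
by rewrite ler_piMr ?lecR.
Qed.

Let nrm (T : bounded_op) : R[i] := (op_norm T)%:C.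

Let ler_nrmD S T : nrm (S + T) <= nrm S + nrm T.
Proof.
rewrite -realCD lecR ge_op_norm ?addr_ge0 ?op_norm_ge0// => x.
by rewrite realCD mulrDl (le_trans (ler_normD _ _))// lerD// op_norm_le.
Qed.

Let nrmZ_le (k : R[i]) T : nrm (k *: T) <= `|k| * nrm T.
Proof.
rewrite -[`|k|]RRe_normC -realCM lecR ge_op_norm//.
  rewrite mulr_ge0 ?op_norm_ge0//.
  by have := normr_ge0 k; rewrite lecE => /andP[].
move=> x; rewrite realCM RRe_normC -mulrA.
by rewrite [leLHS]normrZ ler_wpM2l// op_norm_le.
Qed.

Let nrm0_eq0 T : nrm T = 0 -> T = 0.
Proof.
move=> T0; apply/val_inj/funext => x /=; apply/normr0_eq0/le_anti.
by rewrite normr_ge0 (le_trans (op_norm_le T x))// -/(nrm T) T0 mul0r.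
Qed.

Let nrmZ (k : R[i]) T : nrm (k *: T) = `|k| * nrm T.
Proof.
have [->|k0] := eqVneq k 0.
  apply/le_anti; rewrite nrmZ_le normr0 mul0r lecR op_norm_ge0//.
apply/le_anti; rewrite nrmZ_le/= -ler_pdivlMl ?normr_gt0// -normfV.
by rewrite -{1}[T](scalerK k0) nrmZ_le.
Qed.

HB.instance Definition _ :=
  @Lmodule_isNormed.Build R[i] bounded_op nrm ler_nrmD nrmZ nrm0_eq0.

Lemma op_normE (T : bounded_op) : `|T| = (op_norm T)%:C.
Proof. by []. Qed.

Lemma ler_norm_op (T : bounded_op) x : `|T x| <= `|T| * `|x|.
Proof. exact: op_norm_le. Qed.

Let bounded_op_complete (F : set_system bounded_op) :
  ProperFilter F -> cauchy F -> cvg F.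
Proof.
move=> FF Fc.
have Funif (e : R[i]) : 0 < e ->
    exists2 Q, F Q & forall T, Q T -> \forall S \near F, `|S - T| < e.
  move=> e0; have /cauchy_ballP/(_ e e0)[[P Q] /= [FP FQ] PQ] := Fc.
  exists Q => // T QT; apply: filterS FP => S PS.
  by have := PQ (S, T) (conj PS QT); rewrite -ball_normE.
have opB (S T : bounded_op) x : (S - T) x = S x - T x by [].
have Fx x : cvg ((T : bounded_op) x @[T --> F]).
  apply: cauchy_cvg; apply/cauchy_ballP => e e0.
  have c0 : 0 < `|x| + 1 by rewrite ltr_wpDl.
  have /cauchy_ballP/(_ (e / (`|x| + 1)))[|[P Q] /= [FP FQ] PQ] := Fc.
    by rewrite divr_gt0.
  exists ((fun T : bounded_op => T x) @` P, (fun T : bounded_op => T x) @` Q).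
    split; [apply: filterS FP|apply: filterS FQ]; exact: preimage_image.
  move=> [_ _] [/= [S PS <-] [T QT <-]]; have := PQ (S, T) (conj PS QT).
  rewrite -!ball_normE /= -opB => ST.
  rewrite (le_lt_trans (ler_norm_op _ _))//.
  rewrite (@le_lt_trans _ _ (`|S - T| * (`|x| + 1)))//.
    by rewrite ler_wpM2l// lerDl.
  by rewrite -ltr_pdivlMr.
pose L x := lim ((T : bounded_op) x @[T --> F]).
have FL x : (T : bounded_op) x @[T --> F] --> L x by exact: Fx.
have linL : linear L.
  move=> k x y.
  suff Fkxy : (T : bounded_op) (k *: x + y) @[T --> F] --> k *: L x + L y.
    exact: (cvg_unique (@norm_hausdorff _ H) (FL _) Fkxy).
  have Fkxy : k *: (T : bounded_op) x + (T : bounded_op) y @[T --> F] --> k *: L x + L y.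
    by apply: cvgD => //; apply: cvgZr.
  apply: cvg_trans Fkxy; apply: near_eq_cvg; apply: nearW => T.
  by rewrite linearP.
have FLunif (e : R[i]) : 0 < e ->
    \forall T \near F, forall x, `|L x - (T : bounded_op) x| <= e * `|x|.
  move=> e0; have [Q FQ QF] := Funif e e0.
  apply: filterS FQ => T QT x; apply/ler_addgt0Pr => d d0.
  have /cvgrPdist_lt/(_ d d0) Ld := FL x.
  have [S [ST SL]] := filter_ex (filterI (QF T QT) Ld).
  rewrite -(subrKA (S x)) (le_trans (ler_normD _ _))// addrC lerD ?(ltW SL)//.
  by rewrite -opB (le_trans (ler_norm_op _ _))// ler_wpM2r// ltW.
have bL : L \in is_bounded_linear.
  apply/is_bounded_linearP; split => //.
  have [T LT] := filter_ex (FLunif 1 ltr01).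
  exists (1 + op_norm T) => x; rewrite realCD mulrDl -(subrK (T x) (L x)).
  by rewrite (le_trans (ler_normD _ _))// lerD ?op_norm_le// LT.
apply/cvg_ex; exists (BoundedOp bL); apply/cvgrPdist_le => e e0.
apply: filterS (FLunif e e0) => T LT.
have eE : (complex.Re e)%:C = e by exact/RRe_real/gtr0_real.
rewrite op_normE -eE lecR ge_op_norm//; first by rewrite -lecR eE ltW.
by move=> x; rewrite eE; exact: LT.
Qed.
HB.instance Definition _ := Uniform_isComplete.Build bounded_op bounded_op_complete.

Fact op_one_subproof : (@id H) \in is_bounded_linear.
Proof.
by apply/is_bounded_linearP; split=> //; exists 1 => x; rewrite mul1r.
Qed.

Definition op_one := BoundedOp op_one_subproof.

Fact op_mul_subproof (S T : bounded_op) : S \o T \in is_bounded_linear.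
Proof.
apply/is_bounded_linearP; split=> [k x y|]; first by rewrite /= !linearP.
exists (op_norm S * op_norm T) => x /=; rewrite realCM -mulrA.
by rewrite (le_trans (op_norm_le _ _))// ler_wpM2l ?op_norm_le// lecR op_norm_ge0.
Qed.

Definition op_mul S T := BoundedOp (op_mul_subproof S T).

Let mulA : associative op_mul.
Proof. by move=> x y z; exact: val_inj. Qed.
Let mul1l : left_id op_one op_mul.
Proof. by move=> x; exact: val_inj. Qed.
Let mul1r : right_id op_one op_mul.
Proof. by move=> x; exact: val_inj. Qed.
Let mulDl : left_distributive op_mul +%R.
Proof. by move=> x y z; exact: val_inj. Qed.
Let mulDr : right_distributive op_mul +%R.
Proof. by move=> x y z; apply/val_inj/funext => u /=; rewrite !fctE/= linearD. Qed.
Let mulZl (k : R[i]) x y : op_mul (k *: x) y = k *: op_mul x y.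
Proof. exact: val_inj. Qed.
Let mulZr (k : R[i]) x y : op_mul x (k *: y) = k *: op_mul x y.
Proof. by apply/val_inj/funext => u /=; rewrite !fctE/= linearZ. Qed.
Let ler_norm_mul S T : `|op_mul S T| <= `|S| * `|T|.
Proof.
rewrite !op_normE -realCM lecR ge_op_norm ?mulr_ge0 ?op_norm_ge0// => x /=.
rewrite realCM -mulrA (le_trans (op_norm_le _ _))//.
by rewrite ler_wpM2l ?op_norm_le// lecR op_norm_ge0.
Qed.

HB.instance Definition _ :=
  CompleteNormedModule_isBanachAlgebra.Build R[i] bounded_op
    mulA mul1l mul1r mulDl mulDr mulZl mulZr ler_norm_mul.

End BoundedOperators.

Arguments op_one {R H}.

(** * The two algebras generated by isometries with orthogonal ranges *)

Section FreeSemigroup.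
Context {R : realType} {H : hilbertType R}.

Lemma inner_CauchySchwarz (x y : H) : `|inner x y| <= `|x| * `|y|.
Proof.
have [->|y0] := eqVneq y 0; first by rewrite linear0r !normr0 mulr0.
rewrite -(@ler_pXn2r _ 2)// ?nnegrE ?mulr_ge0// exprMn -!inner_norm.
have yy0 : 0 < inner y y by rewrite inner_norm exprn_gt0// normr_gt0.
have := dnorm_ge0 inner (inner y y *: x - inner x y *: y).
rewrite dnormB !dnormZ linearZl_LR linearZr_LR/= [Num.conj _ * _]mulrC -normCK.
have conjN : Num.conj (inner y y * `|inner x y| ^+ 2) =
    inner y y * `|inner x y| ^+ 2.
  by apply: conj_Creal; rewrite realM ?ger0_real ?exprn_ge0// ltW.
rewrite conjN (ger0_norm (ltW yy0)) [`|inner x y| ^+ 2 * _]mulrC opprD addrA addrK.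
rewrite expr2 -mulrA -mulrBr pmulr_rge0// subr_ge0.
by rewrite [leRHS]mulrC.
Qed.

(* The weak operator topology is the initial topology for the matrix
   coefficients T |-> <T x, y>. R[i]^o is R[i] with the topology of its norm. *)
Definition wot_eval (T : bounded_op H) : {ptws (H * H)%type -> R[i]^o} :=
  fun p => inner (T p.1) p.2.

Definition wot : topologicalType := initial_topology wot_eval.

Lemma wot_closed_closed (M : set (bounded_op H)) :
  @closed wot M -> closed M.
Proof.
move=> cM.
have key (T : bounded_op H) (x y : H) :
    (inner ((S : bounded_op H) x) y : R[i]^o) @[S --> T] --> inner (T x) y.
  have FT : Filter (nbhs T) := nbhs_filter T.
  apply/cvgrPdist_le => e e0; have c0 : 0 < `|x| * `|y| + 1.
    by rewrite ltr_wpDl// mulr_ge0.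
  near=> S; rewrite [X in `|X|](_ : _ = inner ((T - S) x) y); last first.
    exact/esym/linearBl.
  rewrite [leLHS](_ : _ = `|inner ((T - S) x) y|)//.
  rewrite (le_trans (inner_CauchySchwarz _ _))//.
  rewrite (@le_trans _ _ (`|T - S| * `|x| * `|y|))//.
    by rewrite ler_wpM2r// ler_norm_op.
  rewrite -mulrA (@le_trans _ _ (`|T - S| * (`|x| * `|y| + 1)))//.
    by rewrite ler_wpM2l// lerDl.
  rewrite -ler_pdivlMr//; near: S.
  by apply: cvgr_dist_le; [exact: cvg_id|rewrite divr_gt0].
have idC : continuous (id : bounded_op H -> wot).
  apply: (@continuous_comp_initial (bounded_op H) (bounded_op H) _ wot_eval id).
  move=> T; apply/(pointwise_cvgP _ (fmap_filter _ (nbhs_filter T))) => -[x y].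
  exact: key.
exact: (preimage_closed (fun T _ => idC T) cM).
Unshelve. all: by end_near. Qed.

Lemma norm_generated_closed (X : set (bounded_op H)) :
  closed (unital_subalgebra_generated closed X).
Proof. by apply: closed_bigI => M [[]]. Qed.

Lemma wot_generated_closed (X : set (bounded_op H)) :
  closed (unital_subalgebra_generated (fun M => @closed wot M) X).
Proof. by apply: closed_bigI => M [[_ /wot_closed_closed]]. Qed.

Arguments norm_generated_closed : clear implicits.
Arguments wot_generated_closed : clear implicits.

Variable n : nat.
Implicit Type S : 'I_n -> bounded_op H.

Definition isometries_with_orthogonal_ranges S : Prop :=
  (forall i x, `|S i x| = `|x|) /\
  (forall i j, i != j -> forall x y, inner (S i x) (S j y) = 0).

(* The identity operator belongs to every unital subalgebra of B(H), so the
   generators are just the isometries. *)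
Definition noncommutative_disc_algebra S : banachAlgType R[i] :=
  subalg_sort (ClosedSubalgebra
    (unital_subalgebra_generatedP closed (range S))
    (norm_generated_closed (range S))).

Definition free_semigroup_algebra S : banachAlgType R[i] :=
  subalg_sort (ClosedSubalgebra
    (unital_subalgebra_generatedP (fun M => @closed wot M) (range S))
    (wot_generated_closed (range S))).

End FreeSemigroup.

(* Main.v *)
Require Import Defs.
From HB Require Import structures.
From mathcomp Require Import all_boot all_order all_algebra.
From mathcomp Require Import sesquilinear complex ring lra.
From mathcomp Require Import all_classical all_reals all_analysis.

(** Call s_0, s_1 two of the generating isometries, t_i the adjoint of s_i, and
    M the generated algebra, closed in norm or in the weak operator topology.

    Right stable rank. The m operators v_j = s_1^(j+1) s_0 have left inverses
    w_j = t_0 t_1^(j+1), biorthogonal to them, and w_j s_0 = 0. Suppose that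
    sum_j a_j b_j = 1 with a_j close to v_j. Applied to s_0 this says
    s_0 = sum_j a_j T_j with T_j = b_j s_0, and multiplication by w_k gives
    0 = T_k + small terms in the T_j. Hence all T_j vanish, and so does s_0,
    which is absurd: the right-invertible rows miss a ball around v
    ([rtsr_left_inverses]).

    Left stable rank, easy case. If t_0 and t_1 lie in M, the mirror argument
    applies to the column w_j, multiplied on the right by v_k
    ([ltsr_left_inverses]).

    Left stable rank, other case. Let J be the right ideal of the sums
    sum_i s_i A_i with A_i in M; it is closed because A_i = t_i (sum_j s_j A_j).
    If J contains 1, every t_i lies in M and the easy case applies. Otherwise
    C1 + J is again closed, because J stays away from 1, and it is an algebra,
    so it is all of M: every x in M is uniquely
    phi(x) 1 + sum_i s_i D_i(x), where phi is a bounded character and the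
    bounded maps D_i(x) = t_i (x - phi(x)) satisfy
    D_i(x y) = phi(x) D_i(y) + D_i(x) y, that is, are Fox derivatives
    ([dichotomy], [ltsr_no_unit]). Iterating them attaches to x a formal power
    series in noncommuting variables, multiplicatively. Its coefficients grow at
    most geometrically, so a small enough geometric weight makes the weighted
    supremum of the coefficients a norm for which right multiplication by M is
    bounded. Right multiplication by v_j = s_0 s_1^(j+1) only shifts
    coefficients, to words that determine j, and the empty word is not among
    them. If sum_j b_j a_j = 1 with a_j close to v_j, comparing the coefficients
    at those words bounds every coefficient of the b_j by half the supremum of
    all of them. So the coefficients of the b_j vanish, contradicting
    sum_j phi(b_j) phi(a_j) = 1 ([ltsr_fox]).

    Both closures are treated at once through families of seminorms: the only
    topological input is that left multiplication by an operator with an adjoint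
    is continuous ([operator_seminorms]). *)

Set Implicit Arguments.
Unset Strict Implicit.
Unset Printing Implicit Defensive.

Import Order.TTheory GRing.Theory Num.Theory.
Import numFieldNormedType.Exports.

Local Open Scope classical_set_scope.
Local Open Scope ring_scope.
Local Open Scope complex_scope.

(** * Real-valued norms *)

Section RealNorm.
Context {R : realType}.

(** Norms over the complex scalars take their values in the partially ordered
    field R[i]; the real part brings them back to the ordered field R. *)
Definition rnorm (V : normedZmodType R[i]) (x : V) : R := complex.Re `|x|.

Lemma rnormE (V : normedZmodType R[i]) (x : V) : (rnorm x)%:C = `|x|.
Proof. by apply: RRe_real; rewrite normr_real. Qed.

Let realCD (x y : R) : (x + y)%:C = x%:C + y%:C.
Proof. exact: rmorphD. Qed.

Let realCM (x y : R) : (x * y)%:C = x%:C * y%:C.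
Proof. exact: rmorphM. Qed.

Section NormedZmodule.
Context {V : normedZmodType R[i]}.
Implicit Types x y : V.

Lemma rnorm_le x (r : R) : (rnorm x <= r) = (`|x| <= r%:C).
Proof. by rewrite -lecR rnormE. Qed.

Lemma rnorm_lt x (r : R) : (rnorm x < r) = (`|x| < r%:C).
Proof. by rewrite -ltcR rnormE. Qed.

Lemma rnorm_ge0 x : 0 <= rnorm x.
Proof. by rewrite -lecR rnormE normr_ge0. Qed.

Lemma rnorm0 : rnorm (0 : V) = 0.
Proof. by rewrite /rnorm normr0. Qed.

Lemma rnorm_eq0 x : rnorm x = 0 -> x = 0.
Proof. by move=> x0; apply: normr0_eq0; rewrite -rnormE x0. Qed.

Lemma rnorm_gt0 x : x != 0 -> 0 < rnorm x.
Proof. by rewrite -ltcR rnormE normr_gt0. Qed.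

Lemma rnormN x : rnorm (- x) = rnorm x.
Proof. by rewrite /rnorm normrN. Qed.

Lemma rnormB x y : rnorm (x - y) = rnorm (y - x).
Proof. by rewrite /rnorm distrC. Qed.

Lemma ler_rnormD x y : rnorm (x + y) <= rnorm x + rnorm y.
Proof. by rewrite rnorm_le realCD !rnormE ler_normD. Qed.

Lemma ler_rnorm_sum (I : Type) (s : seq I) (F : I -> V) :
  rnorm (\sum_(i <- s) F i) <= \sum_(i <- s) rnorm (F i).
Proof.
elim/big_ind2 : _ => [|x r y t xr yt|//]; first by rewrite rnorm0.
by rewrite (le_trans (ler_rnormD _ _))// lerD.
Qed.

End NormedZmodule.

Lemma rnormM (a b : R[i]) : rnorm (a * b) = rnorm a * rnorm b.
Proof. by apply: (@complexI R); rewrite realCM !rnormE normrM. Qed.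

Lemma rnorm1 : rnorm (1 : R[i]) = 1.
Proof. by rewrite /rnorm normr1. Qed.

Lemma rnormZ (V : normedModType R[i]) (k : R[i]) (x : V) :
  rnorm (k *: x) = rnorm k * rnorm x.
Proof. by apply: (@complexI R); rewrite realCM !rnormE normrZ. Qed.

Lemma ler_rnorm_bmul (A : banachAlgType R[i]) (x y : A) :
  rnorm (bmul x y) <= rnorm x * rnorm y.
Proof. by rewrite rnorm_le realCM !rnormE ler_norm_bmul. Qed.

End RealNorm.

(** * Identities in Banach algebras *)

Section BanachAlgebraTheory.
Context {K : numFieldType} {A : banachAlgType K}.
Implicit Types x y z : A.

Lemma bmulr0 x : bmul x 0 = 0.
Proof. by rewrite -[0 in LHS](scale0r (0 : A)) bmulZr scale0r. Qed.

Lemma bmul0r x : bmul 0 x = 0.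
Proof. by rewrite -[0 in LHS](scale0r (0 : A)) bmulZl scale0r. Qed.

Lemma bmulNr x y : bmul x (- y) = - bmul x y.
Proof. by rewrite -scaleN1r bmulZr scaleN1r. Qed.

Lemma bmulNl x y : bmul (- x) y = - bmul x y.
Proof. by rewrite -scaleN1r bmulZl scaleN1r. Qed.

Lemma bmulBr x y z : bmul x (y - z) = bmul x y - bmul x z.
Proof. by rewrite bmulDr bmulNr. Qed.

Lemma bmulBl x y z : bmul (x - y) z = bmul x z - bmul y z.
Proof. by rewrite bmulDl bmulNl. Qed.

Lemma bmul_sumr (I : Type) (s : seq I) (F : I -> A) x :
  bmul x (\sum_(i <- s) F i) = \sum_(i <- s) bmul x (F i).
Proof. exact: (big_morph _ (bmulDr x) (bmulr0 x)). Qed.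

Lemma bmul_suml (I : Type) (s : seq I) (F : I -> A) x :
  bmul (\sum_(i <- s) F i) x = \sum_(i <- s) bmul (F i) x.
Proof. exact: (big_morph _ (fun y z => bmulDl y z x) (bmul0r x)). Qed.

Definition bexp x (k : nat) : A := iter k (bmul x) bone.

Lemma bexpSr x k : bexp x k.+1 = bmul (bexp x k) x.
Proof.
elim: k => [|k IH]; first by rewrite /bexp/= bmul1l bmul1r.
by rewrite /bexp iterS -/(bexp x k.+1) {1}IH bmulA.
Qed.

End BanachAlgebraTheory.

(** * Infinite stable rank *)

Section InfiniteRank.
Context {R : realType}.

Lemma least_positive_infty (P : nat -> Prop) :
  (forall m, (0 < m)%N -> ~ P m) -> least_positive P = +oo%E.
Proof.
rewrite /least_positive; case: pselect => // ex nP.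
by have [m /asboolP[m0 /(nP m m0)]] := ex.
Qed.

Lemma not_dense_ball (A : banachAlgType R[i]) (m : nat) (P : set 'rV[A]_m)
    (v : 'I_m -> A) (d : R) : 0 < d ->
  (forall a, P a -> ~ forall j, rnorm (a 0 j - v j) < d) -> ~ dense P.
Proof.
move=> d0 Pv dP; pose u : 'rV[A]_m := \row_j v j.
have dC : 0 < d%:C :> R[i] by rewrite ltcR.
have [|a [/interior_subset ua Pa]] := dP _ _ (@open_interior _ (ball u d%:C)).
  by exists u; exact: nbhsx_ballx.
apply: (Pv a Pa) => j; case: ua => _ /(_ 0 j).
by rewrite mxE -ball_normE /= rnormB rnorm_lt.
Qed.

(** A family dominated by a small multiple of its own sum vanishes: this is
    how a perturbation that is too small to matter is discarded. *)
Lemma dominated_family_eq0 (m : nat) (t : 'I_m -> R) (d : R) :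
  (forall k, 0 <= t k) -> m%:R * d < 1 ->
  (forall k, t k <= d * \sum_j t j) -> forall k, t k = 0.
Proof.
move=> t0 md td; set s := \sum_j t j in td.
have s0 : 0 <= s by apply: sumr_ge0.
have sle : s <= m%:R * d * s.
  rewrite {1}/s (le_trans (ler_sum _ (fun k _ => td k)))//.
  by rewrite sumr_const card_ord -[leLHS]mulr_natl mulrA.
have /eqP : s = 0 by nra.
by rewrite psumr_eq0 // => /allP s00 k; apply/eqP/s00; rewrite mem_index_enum.
Qed.

End InfiniteRank.

(** * Rows and columns with biorthogonal systems *)

Section OneSidedInverses.
Context {R : realType} {B : banachAlgType R[i]}.

Section Biorthogonal.
Variables s0 s1 t0 t1 : B.
Hypotheses (t0s0 : bmul t0 s0 = bone) (t1s1 : bmul t1 s1 = bone).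
Hypotheses (t0s1 : bmul t0 s1 = 0) (t1s0 : bmul t1 s0 = 0).

(** From the two given elements, arbitrarily long biorthogonal systems: the
    words s1^(j+1) s0 begin with different numbers of letters s1. All of them
    begin with s1, which leaves s0 (and t0 on the other side) to be
    annihilated. *)
Let v j := bmul (bexp s1 j.+1) s0.
Let w j := bmul t0 (bexp t1 j.+1).

Let texp_s0 j : bmul (bexp t1 j.+1) s0 = 0.
Proof. by rewrite bexpSr -bmulA t1s0 bmulr0. Qed.

Let texp_v j k : bmul (bexp t1 j) (bmul (bexp s1 (j + k)) s0) =
  bmul (bexp s1 k) s0.
Proof.
elim: j => [|j IH]; first by rewrite bmul1l.
rewrite bexpSr addSn /bexp iterS -!/(bexp _ _) -!bmulA.
by rewrite (bmulA t1 s1) t1s1 bmul1l IH.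
Qed.

Lemma biorthogonal j k : bmul (w j) (v k) = (if j == k then bone else 0).
Proof.
rewrite /w /v -bmulA; case: (ltngtP j k) => jk.
- have -> : k.+1 = (j.+1 + (k - j.+1).+1)%N by rewrite addnS subnKC.
  by rewrite texp_v /bexp iterS -bmulA bmulA t0s1 bmul0r.
- have -> : bmul (bexp t1 j.+1) (bmul (bexp s1 k.+1) s0) =
      bmul (bexp t1 (j - k)) s0.
    have {1}-> : j.+1 = (j - k + k.+1)%N by rewrite addnS subnK // ltnW.
    elim: k.+1 (j - k)%N => [|i IH] l; first by rewrite addn0 bmul1l.
    rewrite addnS bexpSr -[LHS]bmulA /bexp [iter i.+1 _ _]iterS -!/(bexp _ _).
    by rewrite -bmulA (bmulA t1 s1) t1s1 bmul1l IH.
  by rewrite -[(j - k)%N]prednK ?subn_gt0// texp_s0 bmulr0.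
- by rewrite jk -{2}[k.+1]addn0 texp_v bmul1l t0s0.
Qed.

Lemma biorthogonal_s0 j : bmul (w j) s0 = 0.
Proof. by rewrite /w -bmulA texp_s0 bmulr0. Qed.

Lemma biorthogonal_t0 j : bmul t0 (v j) = 0.
Proof. by rewrite /v /bexp iterS -bmulA bmulA t0s1 bmul0r. Qed.

End Biorthogonal.

Variable M : closed_subalgebra B.
Hypothesis one_neq0 : bone <> 0 :> B.

Lemma subalg_val_sum (I : Type) (r : seq I) (F : I -> subalg_sort M) :
  subalg_val (\sum_(i <- r) F i) = \sum_(i <- r) subalg_val (F i).
Proof. exact: (raddf_sum val). Qed.

Lemma subalg_valB (x y : subalg_sort M) :
  subalg_val (x - y) = subalg_val x - subalg_val y.
Proof. exact: (raddfB val). Qed.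

Let small_radius (m : nat) (w : nat -> B) :
  exists2 d : R, 0 < d & exists2 e : R, m%:R * e < 1 &
    forall j (x : B), (j < m)%N -> rnorm x < d -> rnorm (w j) * rnorm x <= e.
Proof.
pose C := 1 + \sum_(j < m) rnorm (w j).
have C1 : 1 <= C by rewrite lerDl sumr_ge0 // => j _; exact: rnorm_ge0.
exists (C * m.+1%:R)^-1; first by rewrite invr_gt0 mulr_gt0 // (lt_le_trans _ C1).
exists (m.+1%:R)^-1; first by rewrite ltr_pdivrMr // mul1r ltr_nat.
move=> j x jm xd; rewrite (@le_trans _ _ (C * (C * m.+1%:R)^-1)) //.
  apply: ler_pM; rewrite ?rnorm_ge0 ?(ltW xd) //.
  rewrite /C (bigD1 (Ordinal jm)) //= addrCA lerDl addr_ge0 // sumr_ge0 // => i _.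
  exact: rnorm_ge0.
by rewrite invfM mulVKf // gt_eqF // (lt_le_trans _ C1).
Qed.

(** A row close to the v_j would represent s0 by entries T_j that the left
    inverses, which annihilate s0, show to be dominated by their own small
    multiples. *)
Lemma rtsr_left_inverses (s0 s1 : subalg_sort M) (t0 t1 : B) :
  bmul t0 (subalg_val s0) = bone -> bmul t1 (subalg_val s1) = bone ->
  bmul t0 (subalg_val s1) = 0 -> bmul t1 (subalg_val s0) = 0 ->
  rtsr (subalg_sort M) = +oo%E.
Proof.
move=> t0s0 t1s1 t0s1 t1s0; apply: least_positive_infty => m m0.
pose v j := bmul (bexp s1 j.+1) s0; pose w j := bmul t0 (bexp t1 j.+1).
have valv j : subalg_val (v j) =
    bmul (bexp (subalg_val s1) j.+1) (subalg_val s0).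
  by rewrite /v; congr (bmul _ _); elim: j.+1 => //= k <-.
have [d d0 [e me small_e]] := small_radius m w.
apply: (@not_dense_ball _ _ _ _ (fun j : 'I_m => v j) d d0) => a [b ab1] av.
pose T j := bmul (subalg_val (b 0 j)) (subalg_val s0).
have s0E : subalg_val s0 = \sum_j bmul (subalg_val (a 0 j)) (T j).
  have := congr1 (fun x => bmul (subalg_val x) (subalg_val s0)) ab1.
  rewrite /= bmul1l subalg_val_sum bmul_suml => <-.
  by apply: eq_bigr => j _; rewrite /T bmulA.
have T0 k : rnorm (T k) = 0.
  move: k; apply: (@dominated_family_eq0 _ _ (fun k => rnorm (T k)) e) => // k.
    exact: rnorm_ge0.
  have TE : T k = - \sum_j bmul (w k) (bmul (subalg_val (a 0 j - v j)) (T j)).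
    apply/eqP; rewrite -addr_eq0 -bmul_sumr; apply/eqP.
    transitivity (bmul (w k) (subalg_val s0)); last first.
      exact: biorthogonal_s0.
    rewrite s0E.
    transitivity (bmul (w k) (\sum_(j < m) bmul (subalg_val (v j)) (T j)) +
       bmul (w k) (\sum_j bmul (subalg_val (a 0 j - v j)) (T j))).
      congr (_ + _); rewrite bmul_sumr (bigD1 k) // big1.
        by rewrite bmulA valv biorthogonal // eqxx bmul1l /= addr0.
      move=> j /andP[_ jk]; rewrite bmulA valv biorthogonal // val_eqE eq_sym (negbTE jk).
      by rewrite bmul0r.
    rewrite -bmulDr -big_split; congr (bmul _ _); apply: eq_bigr => j _.
    apply/esym; rewrite -{1}[subalg_val _](subrK (subalg_val (v j))).
    by rewrite -subalg_valB addrC; exact: bmulDl.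
  rewrite {1}TE rnormN (le_trans (ler_rnorm_sum _ _))// mulr_sumr ler_sum // => j _.
  rewrite bmulA (le_trans (ler_rnorm_bmul _ _))// ler_wpM2r ?rnorm_ge0 //.
  rewrite (le_trans (ler_rnorm_bmul _ _))//.
  by apply: small_e => //; exact: av.
have s00 : subalg_val s0 = 0.
  by rewrite s0E big1 // => j _; rewrite (rnorm_eq0 (T0 j)) bmulr0.
by apply: one_neq0; rewrite -t0s0 s00 bmulr0.
Qed.

(** The mirror image: the left inverses now belong to the subalgebra, the
    elements that they invert only to the ambient algebra. *)
Lemma ltsr_left_inverses (s0 s1 : B) (t0 t1 : subalg_sort M) :
  bmul (subalg_val t0) s0 = bone -> bmul (subalg_val t1) s1 = bone ->
  bmul (subalg_val t0) s1 = 0 -> bmul (subalg_val t1) s0 = 0 ->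
  ltsr (subalg_sort M) = +oo%E.
Proof.
move=> t0s0 t1s1 t0s1 t1s0; apply: least_positive_infty => m m0.
pose v j := bmul (bexp s1 j.+1) s0; pose w j := bmul t0 (bexp t1 j.+1).
have valw j : subalg_val (w j) =
    bmul (subalg_val t0) (bexp (subalg_val t1) j.+1).
  by rewrite /w; congr (bmul _ _); elim: j.+1 => //= k <-.
have [d d0 [e me small_e]] := small_radius m v.
apply: (@not_dense_ball _ _ _ _ (fun j : 'I_m => w j) d d0) => a [b ab1] aw.
pose T j := bmul (subalg_val t0) (subalg_val (b 0 j)).
have t0E : subalg_val t0 = \sum_j bmul (T j) (subalg_val (a 0 j)).
  have := congr1 (fun x => bmul (subalg_val t0) (subalg_val x)) ab1.
  rewrite /= bmul1r subalg_val_sum bmul_sumr => <-.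
  by apply: eq_bigr => j _; rewrite /T -bmulA.
have T0 k : rnorm (T k) = 0.
  move: k; apply: (@dominated_family_eq0 _ _ (fun k => rnorm (T k)) e) => // k.
    exact: rnorm_ge0.
  have TE : T k = - \sum_j bmul (bmul (T j) (subalg_val (a 0 j - w j))) (v k).
    apply/eqP; rewrite -addr_eq0 -bmul_suml; apply/eqP.
    transitivity (bmul (subalg_val t0) (v k)); last first.
      exact: biorthogonal_t0.
    rewrite t0E.
    transitivity (bmul (\sum_(j < m) bmul (T j) (subalg_val (w j))) (v k) +
       bmul (\sum_j bmul (T j) (subalg_val (a 0 j - w j))) (v k)).
      congr (_ + _); rewrite bmul_suml (bigD1 k) // big1.
        by rewrite -bmulA valw biorthogonal // eqxx bmul1r /= addr0.
      move=> j /andP[_ jk]; rewrite -bmulA valw biorthogonal // val_eqE (negbTE jk).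
      by rewrite bmulr0.
    rewrite -bmulDl -big_split; congr (bmul _ _); apply: eq_bigr => j _.
    apply/esym; rewrite -{1}[subalg_val (a 0 j)](subrK (subalg_val (w j))).
    by rewrite -subalg_valB addrC; exact: bmulDr.
  rewrite {1}TE rnormN (le_trans (ler_rnorm_sum _ _))// mulr_sumr ler_sum // => j _.
  rewrite -bmulA (le_trans (ler_rnorm_bmul _ _))// mulrC ler_wpM2r ?rnorm_ge0 //.
  rewrite (le_trans (ler_rnorm_bmul _ _))// mulrC.
  by apply: small_e => //; exact: aw.
have t00 : subalg_val t0 = 0.
  by rewrite t0E big1 // => j _; rewrite (rnorm_eq0 (T0 j)) bmul0r.
by apply: one_neq0; rewrite -t0s0 t00 bmul0r.
Qed.

End OneSidedInverses.

(** * Characters with Fox derivatives *)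

Section FoxDerivatives.
Context {R : realType} {A : banachAlgType R[i]}.
Variables (phi : A -> R[i]) (D : bool -> A -> A) (s : bool -> A) (C : R).
Hypothesis phi_linear : forall k x y, phi (k *: x + y) = k * phi x + phi y.
Hypothesis phiM : forall x y, phi (bmul x y) = phi x * phi y.
Hypothesis phi1 : phi bone = 1.
Hypothesis phi_s : forall i, phi (s i) = 0.
Hypothesis D_linear : forall i k x y, D i (k *: x + y) = k *: D i x + D i y.
Hypothesis DM :
  forall i x y, D i (bmul x y) = phi x *: D i y + bmul (D i x) y.
Hypothesis D_s : forall i j, D i (s j) = if i == j then bone else 0.
Hypothesis C1 : 1 <= C.
Hypothesis phi_le : forall x, rnorm (phi x) <= C * rnorm x.
Hypothesis D_le : forall i x, rnorm (D i x) <= C * rnorm x.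

(** The coefficient at the word w of the formal power series of x: reading the
    letters of w strips them from the left of x, one derivative at a time. *)
Definition coef (w : seq bool) (x : A) : R[i] :=
  phi (foldl (fun y i => D i y) x w).

Lemma coef_linear w k x y : coef w (k *: x + y) = k * coef w x + coef w y.
Proof.
elim: w x y => [|i w IH] x y; first exact: phi_linear.
by rewrite /coef /= D_linear; exact: IH.
Qed.

Lemma coefD w x y : coef w (x + y) = coef w x + coef w y.
Proof. by rewrite -[x in LHS]scale1r coef_linear mul1r. Qed.

Lemma coef0 w : coef w 0 = 0.
Proof. by apply: (addrI (coef w 0)); rewrite -coefD !addr0. Qed.

Lemma coef_sum w (I : Type) (r : seq I) (F : I -> A) :
  coef w (\sum_(i <- r) F i) = \sum_(i <- r) coef w (F i).
Proof. exact: (big_morph _ (coefD w) (coef0 w)). Qed.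

Lemma coef1 i w : coef (i :: w) bone = 0.
Proof.
have D1 : D i bone = 0.
  have := DM i bone bone; rewrite bmul1l bmul1r phi1 scale1r => /eqP.
  by rewrite -subr_eq0 opprD addrA subrr sub0r oppr_eq0 => /eqP.
by rewrite /coef /= D1; exact: coef0.
Qed.

Lemma coefM i w x y :
  coef (i :: w) (bmul x y) = phi x * coef (i :: w) y + coef w (bmul (D i x) y).
Proof. by rewrite /coef /= DM; exact: coef_linear. Qed.

Lemma coef_le w x : rnorm (coef w x) <= C ^+ (size w).+1 * rnorm x.
Proof.
elim: w x => [|i w IH] x; first by rewrite expr1; exact: phi_le.
rewrite (le_trans (IH (D i x)))// [X in _ <= X * _]exprSr -mulrA.
by rewrite ler_wpM2l ?exprn_ge0 ?D_le // (le_trans ler01).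
Qed.

(** Derivatives act on the left, yet right multiplication by a generator still
    shifts the formal power series: in D_j(x s_i) = phi(x) D_j(s_i) + D_j(x) s_i
    the first term is constant and matters at the last letter alone. *)
Lemma coef_rcons_s u l i x :
  coef (rcons u l) (bmul x (s i)) = if l == i then coef u x else 0.
Proof.
elim: u x => [|j u IH] x.
  rewrite [rcons _ _]/= coefM {2}/coef /= phiM phi_s mulr0 addr0 /coef /= D_s.
  case: eqP => _; rewrite ?phi1 ?mulr1 // (_ : phi 0 = 0) ?mulr0 //.
  exact: (coef0 [::]).
rewrite [rcons _ _]/= coefM IH {1}/coef /= D_s.
suff -> : phi (foldl (fun y a => D a y) (if j == i then bone else 0) (rcons u l)) =
    0.
  by rewrite mulr0 add0r.
case: (j == i); last exact: coef0.
by case: u {IH} => [|k u]; exact: coef1.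
Qed.

Let nseqSr k : nseq k.+1 true = rcons (nseq k true) true.
Proof. by elim: k => //= k ->. Qed.

Lemma coef_cat_sexp u k j l x :
  coef (u ++ nseq (k + l) true) (bmul x (bexp (s true) (j + l))) =
  coef (u ++ nseq k true) (bmul x (bexp (s true) j)).
Proof.
elim: l => [|l IH]; first by rewrite !addn0.
by rewrite !addnS bexpSr bmulA nseqSr -rcons_cat coef_rcons_s eqxx IH.
Qed.

(** The words s_0 s_1^(j+1) are not suffixes of one another, because the last
    s_0 marks where such a suffix begins; so the coefficients of the products
    x_j s_0 s_1^(j+1) live at disjoint sets of words. *)
Lemma coef_cat_word u j k x :
  coef (u ++ false :: nseq k.+1 true)
       (bmul x (bmul (s false) (bexp (s true) j.+1))) =
  if j == k then coef u x else 0.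
Proof.
rewrite -cat_rcons bmulA; case: (ltngtP j k) => jk.
- rewrite -[k.+1](subnK (m := j.+1)) ?ltnS 1?ltnW//.
  rewrite (coef_cat_sexp _ _ 0) bmul1r subSS -[(k - j)%N]prednK ?subn_gt0//.
  by rewrite nseqSr -rcons_cat coef_rcons_s.
- rewrite -[j.+1](subnK (m := k.+1)) ?ltnS 1?ltnW//.
  rewrite (coef_cat_sexp _ 0) cats0 subSS -[(j - k)%N]prednK ?subn_gt0//.
  by rewrite bexpSr bmulA coef_rcons_s.
- rewrite jk (coef_cat_sexp _ 0 0) cats0 bmul1r.
  by rewrite coef_rcons_s eqxx.
Qed.

Let rho : R := (2 * C)^-1.

Let C0 : 0 < C. Proof. exact: lt_le_trans C1. Qed.

Let rho0 : 0 < rho. Proof. by rewrite invr_gt0 mulr_gt0. Qed.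

(** The weight rho beats the growth of the coefficients, so right
    multiplication is bounded for the weighted supremum norm of the
    coefficients. *)
Lemma coefM_le x y (N : R) w :
  (forall u, rnorm (coef u x) * rho ^+ size u <= N) ->
  rnorm (coef w (bmul x y)) * rho ^+ size w <=
    C * N * rnorm y * (2 - 2^-1 ^+ size w).
Proof.
elim: w x N => [|i w IH] x N xN.
  have /= := xN [::]; rewrite !expr0 !mulr1 => pxN.
  rewrite /coef /= phiM rnormM (_ : 2 - 1 = 1) ?mulr1; last by lra.
  by rewrite -mulrA mulrCA ler_pM ?rnorm_ge0 // phi_le.
have N0 : 0 <= N.
  by rewrite (le_trans _ (xN [::]))// mulr_ge0 ?rnorm_ge0.
have Dx u : rnorm (coef u (D i x)) * rho ^+ size u <= N / rho.
  rewrite ler_pdivlMr // -mulrA -exprSr; exact: (xN (i :: u)).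
have {IH} := IH (D i x) (N / rho) Dx.
set a := rnorm (coef w _) * _ => aN.
have {xN} /= := xN [::]; rewrite expr0 mulr1 => pxN.
have yle : rnorm (coef (i :: w) y) * rho ^+ (size w).+1 <=
    C * rnorm y * 2^-1 ^+ (size w).+1.
  have -> : C * rnorm y * 2^-1 ^+ (size w).+1 =
      C ^+ (size w).+2 * rnorm y * rho ^+ (size w).+1.
    have CC : C ^+ (size w).+1 * C^-1 ^+ (size w).+1 = 1.
      by rewrite -exprMn mulfV ?expr1n // gt_eqF.
    rewrite -[LHS]mulr1 -[X in _ * X = _]CC /rho invfM exprMn [C ^+ _.+2]exprS.
    by move: (C ^+ _) (C^-1 ^+ _) (2^-1 ^+ _) => X Y Z; ring.
  by rewrite ler_wpM2r ?exprn_ge0 ?(ltW rho0) // (coef_le (i :: w)).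
rewrite coefM /= (@le_trans _ _ (rnorm (phi x) *
    (rnorm (coef (i :: w) y) * rho ^+ (size w).+1) + a * rho)) //.
  rewrite /a mulrA -[_ * _ * rho]mulrA -exprSr -mulrDl ler_wpM2r //.
    by rewrite exprn_ge0 // ltW.
  by rewrite (le_trans (ler_rnormD _ _))// rnormM.
have aN' : a * rho <= C * N * rnorm y * (2 - 2^-1 ^+ size w).
  rewrite -ler_pdivlMr // (le_trans aN)//.
  by rewrite le_eqVlt; apply/orP; left; apply/eqP; ring.
have pN : rnorm (phi x) * (rnorm (coef (i :: w) y) * rho ^+ (size w).+1) <=
    N * (C * rnorm y * 2^-1 ^+ (size w).+1).
  by rewrite ler_pM ?rnorm_ge0 // mulr_ge0 ?rnorm_ge0 // exprn_ge0 // ltW.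
rewrite (le_trans (lerD pN aN'))// le_eqVlt; apply/orP; left; apply/eqP.
by rewrite exprS; field.
Qed.

(** The target column is v_j = s_0 s_1^(j+1). For a column a within d of it and
    a left inverse b, the coefficient of 1 at u followed by the word of v_k is
    zero, which expresses the coefficient of b_k at u through those of
    b_j (a_j - v_j). *)
Lemma ltsr_fox : ltsr A = +oo%E.
Proof.
apply: least_positive_infty => m m0.
pose v j := bmul (s false) (bexp (s true) j.+1).
(* rho^(m+1) pays for the length of the longest word, m for the number of
   terms, and 2 C is the bound of right multiplication; one factor 2 is left. *)
pose d := rho ^+ m.+1 / (4 * C * m.+1%:R).
have d0 : 0 < d by rewrite divr_gt0 ?exprn_gt0 // !mulr_gt0.
apply: (@not_dense_ball _ _ _ _ (fun j : 'I_m => v j) d d0) => a [b ba1] av.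
have coef_b (u : seq bool) (k : 'I_m) :
    coef u (b 0 k) = - \sum_j coef (u ++ false :: nseq k.+1 true)
                                 (bmul (b 0 j) (a 0 j - v j)).
  set w := u ++ _; apply/eqP; rewrite -addr_eq0; apply/eqP.
  transitivity (coef w (\sum_j bmul (b 0 j) (a 0 j))); last first.
    by rewrite ba1 /w; case: (u) => [|i u'] /=; rewrite coef1.
  have <- : \sum_(j < m) coef w (bmul (b 0 j) (v j)) = coef u (b 0 k).
    rewrite (bigD1 k) //= big1 ?addr0 => [|j jk]; rewrite coef_cat_word.
      by rewrite eqxx.
    by rewrite val_eqE (negbTE jk).
  rewrite coef_sum -big_split; apply: eq_bigr => j _ /=.
  by rewrite -coefD -bmulDr addrC subrK.
have half (N : R) : (forall u j, rnorm (coef u (b 0 j)) * rho ^+ size u <= N) ->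
    forall u j, rnorm (coef u (b 0 j)) * rho ^+ size u <= N / 2.
  move=> bN u k.
  have N0 : 0 <= N.
    by rewrite (le_trans _ (bN [::] k))// mulr_ge0 ?rnorm_ge0.
  rewrite -(ler_pM2r (exprn_gt0 k.+2 rho0)) -mulrA -exprD.
  have sz : size (u ++ false :: nseq k.+1 true) = (size u + k.+2)%N.
    by rewrite size_cat /= size_nseq.
  rewrite -sz coef_b rnormN.
  rewrite (@le_trans _ _ (\sum_(j < m) 2 * C * N * d)) //.
    set w := u ++ _.
    rewrite (le_trans (ler_wpM2r _ (ler_rnorm_sum _ _))) ?exprn_ge0 ?(ltW rho0)//.
    rewrite mulr_suml ler_sum // => j _.
    rewrite (le_trans (coefM_le _ _ (fun u => bN u j)))//.
    rewrite (@le_trans _ _ (C * N * d * 2))//; last first.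
      by rewrite le_eqVlt; apply/orP; left; apply/eqP; ring.
    have CN : 0 <= C * N by rewrite mulr_ge0 // ltW.
    have h0 : (0 : R) <= 2^-1 ^+ size w by rewrite exprn_ge0.
    have h1 : 2^-1 ^+ size w <= 1 :> R by rewrite exprn_ile1 //; lra.
    apply: ler_pM; first by rewrite mulr_ge0 ?rnorm_ge0.
    - by rewrite subr_ge0 (le_trans h1) // ler1n.
    - by rewrite ler_wpM2l // ltW.
    - by rewrite gerBl.
  rewrite sumr_const card_ord -[leLHS]mulr_natl.
  have mm : m%:R / m.+1%:R <= 1 :> R by rewrite ler_pdivrMr // mul1r ler_nat.
  rewrite (@le_trans _ _ (N / 2 * rho ^+ m.+1)) //.
    rewrite [leLHS](_ : _ = N / 2 * rho ^+ m.+1 * (m%:R / m.+1%:R)).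
      by rewrite ler_piMr // mulr_ge0 ?divr_ge0 // exprn_ge0 // ltW.
    by rewrite /d; field; rewrite nat1r pnatr_eq0 /= gt_eqF.
  rewrite ler_wpM2l ?divr_ge0 //.
  rewrite ler_wiXn2l ?(ltW rho0) ?ltnS ?ltn_ord //.
  by rewrite invf_le1 ?mulr_gt0 // (le_trans C1) // ler_peMl ?ler1n // ltW.
pose N := \sum_j C * rnorm (b 0 j).
have bound (p : nat) u j : rnorm (coef u (b 0 j)) * rho ^+ size u <= N / 2 ^+ p.
  elim: p u j => [|p IH] u j; last first.
    by rewrite exprSr invfM mulrA; exact: half.
  rewrite expr0 divr1 (@le_trans _ _ (C * rnorm (b 0 j))) //.
    rewrite (le_trans (ler_wpM2r _ (coef_le _ _))) ?exprn_ge0 ?(ltW rho0)//.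
    rewrite [leLHS](_ : _ = C * rnorm (b 0 j) * (C * rho) ^+ size u).
      rewrite ler_piMr ?mulr_ge0 ?rnorm_ge0 ?(ltW C0) //.
      rewrite exprn_ile1 ?mulr_ge0 ?(ltW C0) ?(ltW rho0) //.
      by rewrite /rho invfM mulrCA mulfV ?gt_eqF // mulr1 invf_le1 // ler1n.
    rewrite exprMn exprS.
    by move: (C ^+ _) (rho ^+ _) => X Y; ring.
  rewrite /N (bigD1 j) //= lerDl sumr_ge0 // => i _.
  by rewrite mulr_ge0 ?rnorm_ge0 // ltW.
have phib j : phi (b 0 j) = 0.
  apply: rnorm_eq0; apply/eqP/negPn/negP => x0.
  have {}x0 : 0 < rnorm (phi (b 0 j)) by rewrite lt_neqAle eq_sym x0 rnorm_ge0.
  pose p := Num.bound (N / rnorm (phi (b 0 j))).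
  have := bound p [::] j; rewrite expr0 mulr1 /coef /= => xN.
  have : N / rnorm (phi (b 0 j)) < 2 ^+ p.
    rewrite (lt_le_trans (y := p%:R)) //; last first.
      by rewrite -natrX ler_nat ltnW // ltn_expl.
    rewrite archi_boundP // divr_ge0 ?rnorm_ge0 // sumr_ge0 // => i _.
    by rewrite mulr_ge0 ?rnorm_ge0 // ltW.
  by rewrite ltr_pdivrMr // mulrC -ltr_pdivrMr ?exprn_gt0 // ltNge xN.
have := coef_sum [::] (index_enum 'I_m) (fun j => bmul (b 0 j) (a 0 j)).
rewrite ba1 /coef /= phi1 big1 => [/eqP|j _]; first by rewrite oner_eq0.
by rewrite phiM phib mul0r.
Qed.

End FoxDerivatives.

(** * Adjoints of isometries *)

Section Adjoint.
Context {R : realType} {H : hilbertType R}.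
Implicit Types x y z : H.

Lemma innerC x y : inner x y = Num.conj (inner y x).
Proof. by rewrite (hermC inner x y) expr0 mul1r. Qed.

Lemma innerZr (k : R[i]) x y : inner x (k *: y) = Num.conj k * inner x y.
Proof. exact: linearZr_LR. Qed.

Lemma innerZl (k : R[i]) x y : inner (k *: x) y = k * inner x y.
Proof. exact: linearZl_LR. Qed.

Lemma innerDl x y z : inner (x + y) z = inner x z + inner y z.
Proof. exact: linearDl. Qed.

Lemma innerDr x y z : inner x (y + z) = inner x y + inner x z.
Proof. exact: linearDr. Qed.

Lemma innerBl x y z : inner (x - y) z = inner x z - inner y z.
Proof. exact: linearBl. Qed.

Lemma innerBr x y z : inner x (y - z) = inner x y - inner x z.
Proof. exact: linearBr. Qed.

Lemma innerNr x y : inner x (- y) = - inner x y.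
Proof. exact: linearNr. Qed.

Lemma rnorm_sqr x : rnorm x ^+ 2 = complex.Re (inner x x).
Proof.
apply: (@complexI R); rewrite inner_norm -rnormE.
have -> : (rnorm x)%:C ^+ 2 = (rnorm x ^+ 2)%:C :> R[i] by rewrite rmorphXn.
by [].
Qed.

Lemma ReD (a b : R[i]) : complex.Re (a + b) = complex.Re a + complex.Re b.
Proof. by case: a b => [a a'] [b b']. Qed.

Lemma ReN (a : R[i]) : complex.Re (- a) = - complex.Re a.
Proof. by case: a. Qed.

Lemma Re_conj (a : R[i]) : complex.Re (Num.conj a) = complex.Re a.
Proof. by case: a. Qed.

Lemma Re_realM (t : R) (a : R[i]) : complex.Re (t%:C * a) = t * complex.Re a.
Proof. by case: a => a b; rewrite /= mul0r subr0. Qed.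

(** Real parts are all that norms see, so complex identities are recovered from
    real ones by rotating the scalar. *)
Lemma Re_mul_eq0 (a : R[i]) : (forall k, complex.Re (k * a) = 0) -> a = 0.
Proof.
move=> a0; apply: normr0_eq0; apply/eqP; rewrite -sqrf_eq0 -rnormE.
have := a0 (Num.conj a); rewrite mulrC -normCK -rnormE.
have <- : (rnorm a ^+ 2)%:C = (rnorm a)%:C ^+ 2 :> R[i] by rewrite rmorphXn.
by move=> /= ->.
Qed.

Lemma rnormB_sqr x y :
  rnorm (x - y) ^+ 2 = rnorm x ^+ 2 + rnorm y ^+ 2 - 2 * complex.Re (inner x y).
Proof.
rewrite !rnorm_sqr (hnormB inner x y) expr0 mul1r !ReD ReN !ReD Re_conj.
by ring.
Qed.

Lemma rnorm_inner x : rnorm (inner x x) = rnorm x ^+ 2.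
Proof. by rewrite rnorm_sqr {1}/rnorm ger0_norm // inner_norm exprn_ge0. Qed.

Lemma rnorm_CauchySchwarz x y : rnorm (inner x y) <= rnorm x * rnorm y.
Proof.
have realCM (a b : R) : (a * b)%:C = a%:C * b%:C by exact: rmorphM.
by rewrite rnorm_le realCM !rnormE inner_CauchySchwarz.
Qed.

Lemma inner_inj x y : (forall z, inner z x = inner z y) -> x = y.
Proof.
move=> xy; apply/eqP; rewrite -subr_eq0; apply/eqP/normr0_eq0/eqP.
by rewrite -sqrf_eq0 -inner_norm innerBr xy subrr.
Qed.

Lemma isometry_inner (S : bounded_op H) :
  (forall x, `|S x| = `|x|) -> forall x y, inner (S x) (S y) = inner x y.
Proof.
move=> iS x y; apply/eqP; rewrite -subr_eq0; apply/eqP/Re_mul_eq0 => k.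
have riS z : rnorm (S z) = rnorm z by rewrite /rnorm iS.
have Re_inner u v : complex.Re (inner (S u) (S v)) = complex.Re (inner u v).
  have := rnormB_sqr (S u) (S v); rewrite -linearB !riS rnormB_sqr.
  by move=> h; lra.
by rewrite mulrBr ReD ReN -!innerZl -linearZ Re_inner subrr.
Qed.

Lemma rnorm_real_sqr (t : R) : rnorm (t%:C : R[i]) ^+ 2 = t ^+ 2.
Proof.
rewrite -[t ^+ 2]ger0_norm ?sqr_ge0 // normrX -sqrtr_sqr; congr (_ ^+ 2).
by rewrite /rnorm normc_def /= expr0n addr0.
Qed.

Lemma complete_seq (u : nat -> H) :
  (forall e : R, 0 < e -> exists N, forall k l, (N <= k)%N -> (N <= l)%N ->
     rnorm (u k - u l) < e) ->
  exists x, forall e : R, 0 < e -> exists N, forall k, (N <= k)%N ->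
    rnorm (u k - x) < e.
Proof.
move=> cu; have realE (e : R[i]) : 0 < e -> (complex.Re e)%:C = e.
  by move=> e0; apply/RRe_real/gtr0_real.
have /cauchy_cvg/cvg_ex[x ux] : cauchy (u @ \oo).
  apply/cauchy_ballP => e e0; rewrite -(realE e e0).
  have [|N uN] := cu (complex.Re e); first by rewrite -ltcR realE.
  exists (u @` [set k | (N <= k)%N], u @` [set k | (N <= k)%N]).
    by split; exists N => // k /= Nk; exists k.
  move=> [_ _] [/= [k Nk <-] [l Nl <-]].
  by rewrite -ball_normE /= -rnorm_lt; exact: uN.
exists x => e e0; move/cvgrPdist_lt : ux => /(_ e%:C).
rewrite ltcR => /(_ e0)[N _ xN]; exists N => k Nk.
by rewrite rnormB rnorm_lt; exact: xN.
Qed.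

Lemma invS_eventually_lt (e : R) : 0 < e -> exists N, forall k, (N <= k)%N ->
  k.+1%:R^-1 < e.
Proof.
move=> e0; exists (Num.bound e^-1) => k Nk; rewrite invf_plt ?posrE //.
by rewrite (lt_le_trans (archi_boundP _)) ?invr_ge0 ?(ltW e0) // ler_nat ltnW.
Qed.

(** A minimizing sequence for the distance from y to the range of S is Cauchy
    by the parallelogram law, and isometry transports this to its preimages. *)
Lemma isometry_projection (S : bounded_op H) y :
  (forall x, `|S x| = `|x|) -> exists z, forall x, inner (S x) (y - S z) = 0.
Proof.
move=> iS; have riS z : rnorm (S z) = rnorm z by rewrite /rnorm iS.
pose q z := rnorm (y - S z) ^+ 2; pose d := inf (range q).
have q_lb : has_lbound (range q) by exists 0 => _ [z _ <-]; exact: sqr_ge0.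
have dq z : d <= q z by apply: ge_inf => //; exists z.
have /choice[u qu] (k : nat) : exists z, q z < d + k.+1%:R^-1.
  have k0 : 0 < k.+1%:R^-1 :> R by rewrite invr_gt0.
  have hq : has_inf (range q) by split=> //; exists (q 0), 0.
  by have [_ [z _ <-] zd] := inf_adherent k0 hq; exists z.
have para a b : rnorm (a - b) ^+ 2 <= 2 * (q a + q b - 2 * d).
  have mid : q (2^-1 *: (a + b)) = (2 * q a + 2 * q b - rnorm (a - b) ^+ 2) / 4.
    set e := y - S a; set f := y - S b.
    have -> : q (2^-1 *: (a + b)) = rnorm (e + f) ^+ 2 / 4.
      rewrite /q (_ : y - _ = 2^-1 *: (e + f)).
        rewrite rnormZ exprMn mulrC; congr (_ * _).
        have -> : (2^-1 : R[i]) = (2^-1)%:C by rewrite fmorphV rmorphMn.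
        by rewrite rnorm_real_sqr; field.
      rewrite linearZ /= linearD /= /e /f addrACA -opprD scalerBr -mulr2n.
      by rewrite -[y *+ 2]scaler_nat scalerA mulVf ?scale1r // pnatr_eq0.
    have -> : rnorm (a - b) ^+ 2 = rnorm (f - e) ^+ 2.
      rewrite -(riS (a - b)) linearB /= /e /f; congr (rnorm _ ^+ 2).
      by rewrite opprB [RHS]addrC addrA subrK.
    have -> : rnorm (e + f) ^+ 2 = rnorm (f - - e) ^+ 2 by rewrite opprK addrC.
    rewrite (rnormB_sqr f e) (rnormB_sqr f (- e)) rnormN innerNr ReN /q -/e -/f.
    lra.
  have := dq (2^-1 *: (a + b)); rewrite mid; lra.
have [z uz] : exists z, forall e : R, 0 < e -> exists N, forall k, (N <= k)%N ->
    rnorm (u k - z) < e.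
  apply: complete_seq => e e0.
  have e20 : 0 < e ^+ 2 / 4 by rewrite divr_gt0 // exprn_gt0.
  have [N small] := invS_eventually_lt e20; exists N => k l Nk Nl.
  rewrite -(ltr_pXn2r (n := 2)) ?nnegrE ?rnorm_ge0 ?(ltW e0) //.
  have := para (u k) (u l); have := qu k; have := qu l.
  have := small k Nk; have := small l Nl.
  by move: (k.+1%:R^-1) (l.+1%:R^-1) => A B; lra.
have qz : q z <= d.
  rewrite leNgt; apply/negP => dqz; set g := rnorm (y - S z).
  have g0 : 0 <= g by exact: rnorm_ge0.
  (* eta is small enough for (g - eta)^2 - eta to stay above d *)
  pose eta := (q z - d) / (2 * g + 2).
  have eta0 : 0 < eta by rewrite divr_gt0 ?subr_gt0 //; lra.
  have etaE : 2 * g * eta + 2 * eta = q z - d by rewrite /eta; field; lra.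
  have [N uN] := uz _ eta0; have [N' small] := invS_eventually_lt eta0.
  have {}uN := uN _ (leq_maxl N N'); have {}small := small _ (leq_maxr N N').
  have := qu (maxn N N'); move: small uN; set k := maxn N N' => small uN quk.
  have gk : g <= rnorm (y - S (u k)) + eta.
    rewrite /g (_ : y - S z = y - S (u k) + S (u k - z)).
      by rewrite (le_trans (ler_rnormD _ _))// lerD2l riS ltW.
    by rewrite linearB /= addrA subrK.
  have gk0 := rnorm_ge0 (y - S (u k)); rewrite /q -/g in etaE quk.
  move: (rnorm (y - S (u k))) (k.+1%:R^-1) gk gk0 quk small {uN} => h b gk gk0 quk bs.
  move: eta eta0 etaE gk bs => t t0 tE gk bs.
  have h2 : h ^+ 2 < d + t by lra.
  have [gt|tg] := leP g t.
    have : g ^+ 2 <= t * g by rewrite expr2 ler_wpM2r.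
    have := mulr_ge0 g0 (ltW t0); have := sqr_ge0 h; lra.
  have : (g - t) ^+ 2 <= h ^+ 2.
    by rewrite ler_pXn2r ?nnegrE //; lra.
  have := sqr_ge0 t; have -> : (g - t) ^+ 2 = g ^+ 2 - 2 * g * t + t ^+ 2 by ring.
  lra.
exists z => x; set e := y - S z.
have real_orth v : complex.Re (inner e (S v)) = 0.
  set c := complex.Re _; set U := rnorm (S v) ^+ 2.
  have U0 : 0 <= U by exact: sqr_ge0.
  (* the variation of the minimal distance along the direction S v *)
  have quad t : 0 <= t ^+ 2 * U - 2 * (t * c).
    have := le_trans qz (dq (z + t%:C *: v)); rewrite {2}/q linearD linearZ /=.
    rewrite opprD addrA -/e rnormB_sqr -/(q z) rnormZ exprMn innerZr.
    rewrite (_ : Num.conj t%:C = t%:C) ?Re_realM -/c; last first.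
      by apply/conj_Creal/complex_realP; exists t.
    rewrite (_ : rnorm t%:C ^+ 2 = t ^+ 2) => [h|]; first by rewrite /U; lra.
    exact: rnorm_real_sqr.
  have := quad (c / (U + 1)).
  have -> : (c / (U + 1)) ^+ 2 * U - 2 * (c / (U + 1) * c) =
      - (c ^+ 2 * ((U + 2) / (U + 1) ^+ 2)) by field; lra.
  rewrite oppr_ge0 pmulr_lle0 ?divr_gt0 ?exprn_gt0 //; try lra.
  by move=> c0; apply/eqP; rewrite -sqrf_eq0 eq_le c0 sqr_ge0.
rewrite innerC; apply/eqP; rewrite conjC_eq0; apply/eqP.
apply: Re_mul_eq0 => k.
have := real_orth (Num.conj k *: x); rewrite linearZ /= innerZr conjCK.
by [].
Qed.

(** The adjoint sends y to the preimage of its projection on the range. *)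
Lemma isometry_adjoint (S : bounded_op H) : (forall x, `|S x| = `|x|) ->
  exists T : bounded_op H, forall x y, inner (S x) y = inner x (T y).
Proof.
move=> iS; have /choice[t tP] := fun y => isometry_projection y iS.
have adj x y : inner (S x) y = inner x (t y).
  have := tP y x; rewrite innerBr (isometry_inner iS) => /eqP.
  by rewrite subr_eq0 => /eqP.
suff bt : t \in @is_bounded_linear R H by exists (BoundedOp bt).
apply/is_bounded_linearP; split=> [k x y|].
  apply: inner_inj => z.
  by rewrite -adj !innerDr !innerZr !adj.
exists 1 => y; rewrite mul1r.
have [->|y0] := eqVneq (t y) 0; first by rewrite normr0.
rewrite -(@ler_pM2l _ `|t y|) ?normr_gt0 // -expr2 -inner_norm -adj.
have Sty : 0 <= inner (S (t y)) y by rewrite adj inner_norm exprn_ge0.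
by rewrite -(ger0_norm Sty) (le_trans (inner_CauchySchwarz _ _)) // iS.
Qed.

Lemma hilbert_neq0 : exists v : H, v != 0.
Proof.
apply: contrapT => nv; apply: (@hilbert_infinite_dim R H).
exists [::] => x; exists (fun=> 0); rewrite big_ord0; apply/eqP.
by apply: contrapT => /negP x0; apply: nv; exists x.
Qed.

Lemma op_one_neq0 : bone <> 0 :> bounded_op H.
Proof.
move=> e; have [v /eqP] := hilbert_neq0; apply.
exact: (congr1 (fun T : bounded_op H => T v) e).
Qed.

(** The scalars inherit completeness from any line of H. *)
Lemma complete_seq_scalar (c : nat -> R[i]) :
  (forall e : R, 0 < e -> exists N, forall k l, (N <= k)%N -> (N <= l)%N ->
     rnorm (c k - c l) < e) ->
  exists a, forall e : R, 0 < e -> exists N, forall k, (N <= k)%N ->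
    rnorm (c k - a) < e.
Proof.
move=> cc; have [v v0] := hilbert_neq0.
have nv0 : 0 < rnorm v by rewrite rnorm_gt0.
have [|h hP] := @complete_seq (fun k => c k *: v).
  move=> e e0; have [|N cN] := cc (e / rnorm v); first by rewrite divr_gt0.
  exists N => k l Nk Nl; rewrite -scalerBl rnormZ -ltr_pdivlMr //.
  exact: cN.
exists (inner h v / inner v v) => e e0.
have [|N hN] := hP (e * rnorm v); first by rewrite mulr_gt0.
exists N => k Nk; have := hN k Nk.
have vv0 : inner v v != 0 by rewrite inner_norm sqrf_eq0 normr_eq0.
have -> : c k - inner h v / inner v v = inner (c k *: v - h) v / inner v v.
  by rewrite innerBl innerZl mulrBl mulfK.
set g := c k *: v - h => gN.
rewrite -(ltr_pM2r nv0) (le_lt_trans _ gN) //.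
rewrite -(ler_pM2r nv0) -mulrA -expr2 -rnorm_inner -rnormM mulfVK //.
exact: rnorm_CauchySchwarz.
Qed.

End Adjoint.

(** * Closedness in the topology of a family of seminorms *)

Section Seminorms.
Context {R : realType} {H : hilbertType R}.
Local Notation B := (bounded_op H).

Definition adjointable (A : B) :=
  exists A' : H -> H, forall x y, inner (A x) y = inner x (A' y).

(** The norm topology and the weak operator topology are both given by such a
    family, and the structure of the generated algebra depends on nothing else. *)
Record operator_seminorms (I : Type) (p : I -> B -> R) : Prop := {
  seminormD : forall i S T, p i (S + T) <= p i S + p i T;
  seminormZ : forall i k T, p i (k *: T) = rnorm k * p i T;
  seminorm_directed : forall i j, exists k,
    forall T, p i T <= p k T /\ p j T <= p k T;
  seminorm_bounded : forall i, exists C, forall T, p i T <= C * rnorm T;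
  seminorm_separated : forall T, (forall i, p i T = 0) -> T = 0;
  seminorm_bmul : forall A i, adjointable A ->
    exists j, exists C, forall T, p i (bmul A T) <= C * p j T }.

Variables (I : Type) (p : I -> B -> R).

Definition adherent (M : set B) (T : B) :=
  forall i (e : R), 0 < e -> exists2 U, M U & p i (U - T) < e.

Definition seminorm_closed (M : set B) := forall T, adherent M T -> M T.

Lemma seminorm_closedI (M N : set B) :
  seminorm_closed M -> seminorm_closed N -> seminorm_closed (M `&` N).
Proof.
move=> cM cN T MNT; split; [apply: cM|apply: cN] => i e e0;
  by have [U [MU NU] UT] := MNT i e e0; exists U.
Qed.

Hypothesis hp : operator_seminorms p.

Let pD := seminormD hp.
Let pZ := seminormZ hp.

Let p0 i : p i 0 = 0.
Proof. by rewrite -(scale0r (0 : B)) pZ rnorm0 mul0r. Qed.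

Let pN i T : p i (- T) = p i T.
Proof. by rewrite -scaleN1r pZ rnormN rnorm1 mul1r. Qed.

Let p_ge0 i T : 0 <= p i T.
Proof.
have := pD i T (- T); rewrite subrr p0 pN => h.
by rewrite -(pmulrn_lge0 _ (n := 2)) // mulr2n.
Qed.

(* A strictly positive constant is more convenient to divide by. *)
Let p_bmul A i : adjointable A ->
  exists j, exists2 C, 0 < C & forall T, p i (bmul A T) <= C * p j T.
Proof.
move=> /(seminorm_bmul hp i)[j [C CP]]; exists j, (`|C| + 1) => [|T].
  by rewrite ltr_wpDl.
rewrite (le_trans (CP T)) // ler_wpM2r // (le_trans (ler_norm _)) //.
by rewrite lerDl.
Qed.

(** The preimage of a closed set under the continuous map T |-> A T. *)
Lemma seminorm_closed_bmul (M : set B) (A : B) : adjointable A ->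
  seminorm_closed M -> seminorm_closed [set T | M (bmul A T)].
Proof.
move=> adjA cM T MT; apply: cM => i e e0.
have [j [C C0 CP]] := p_bmul i adjA.
have [|U MU UT] := MT j (e / C); first by rewrite divr_gt0.
exists (bmul A U) => //; rewrite -bmulBr (le_lt_trans (CP _)) //.
by rewrite mulrC -ltr_pdivlMr.
Qed.

Lemma seminorm_closed_ker (A : B) : adjointable A ->
  seminorm_closed [set T | bmul A T = 0].
Proof.
move=> adjA T AT; apply: (seminorm_separated hp) => i.
have [j [C C0 CP]] := p_bmul i adjA.
apply/eqP; rewrite eq_le p_ge0 andbT; apply/ler_addgt0Pr => e e0.
have [|U MU UT] := AT j (e / C); first by rewrite divr_gt0.
rewrite add0r (_ : bmul A T = - bmul A (U - T)); last first.
  by rewrite bmulBr MU sub0r opprK.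
by rewrite pN (le_trans (CP _)) // mulrC -ler_pdivlMr // ltW.
Qed.

Lemma not_adherent (M : set B) (T : B) : seminorm_closed M -> ~ M T ->
  exists i, exists2 e : R, 0 < e & forall U, M U -> e <= p i (U - T).
Proof.
move=> cM nMT; apply: contrapT => nie; apply: nMT; apply: cM => i e e0.
apply: contrapT => nU; apply: nie; exists i, e => // U MU.
by rewrite leNgt; apply/negP => UT; apply: nU; exists U.
Qed.

(** Modulo a closed subspace that misses E, a multiple of E controls its
    coefficient. *)
Lemma line_coef_bound (M : set B) (E : B) :
  (forall k U, M U -> M (k *: U)) -> seminorm_closed M -> ~ M E ->
  exists i, exists2 e : R, 0 < e &
    forall c U, M U -> rnorm c * e <= p i (c *: E + U).
Proof.
move=> MZ cM nME; have [i [e e0 eP]] := not_adherent cM nME.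
exists i, e => // c U MU; have [->|c0] := eqVneq c 0.
  by rewrite rnorm0 mul0r.
have -> : c *: E + U = (- c) *: ((- c^-1) *: U - E).
  by rewrite scalerBr scalerA mulrNN divff // scale1r scaleNr opprK addrC.
by rewrite pZ rnormN ler_wpM2l ?rnorm_ge0 // eP //; exact: MZ.
Qed.

(** A line added to a closed subspace leaves it closed: the coefficients along
    an approximating sequence are Cauchy by the previous bound. *)
Lemma seminorm_closed_line (M : set B) (E : B) :
  (forall U V, M U -> M V -> M (U - V)) ->
  (forall k U, M U -> M (k *: U)) -> seminorm_closed M -> ~ M E ->
  seminorm_closed [set T | exists c, M (T - c *: E)].
Proof.
move=> MB MZ cM nME T NT; have [i [e e0 eP]] := line_coef_bound MZ cM nME.
(* two elements of the sum close to T have close coefficients *)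
have coef_close U V c c' : M (U - c *: E) -> M (V - c' *: E) ->
    rnorm (c - c') * e <= p i (U - T) + p i (V - T).
  move=> MU MV; rewrite (le_trans (eP _ _ (MB _ _ MU MV))) //.
  rewrite scalerBl opprB addrCA !subrKA -(subrKA T) -[T - V]opprB.
  by rewrite (le_trans (pD _ _ _)) // pN.
have /choice[u /choice[c uP]] (k : nat) :
    exists U, exists c, M (U - c *: E) /\ p i (U - T) < k.+1%:R^-1.
  have [|U [c Mc] UT] := NT i k.+1%:R^-1; first by rewrite invr_gt0.
  by exists U, c.
have [|a aP] := @complete_seq_scalar R H c.
  move=> d d0; have [|N small] := @invS_eventually_lt R (d * e / 2).
    by rewrite divr_gt0 // mulr_gt0.
  exists N => k l Nk Nl; rewrite -(ltr_pM2r e0).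
  have [Mk uk] := uP k; have [Ml ul] := uP l.
  have := coef_close _ _ _ _ Mk Ml; have := small k Nk; have := small l Nl.
  move: uk ul; move: (k.+1%:R^-1) (l.+1%:R^-1) => x y; lra.
exists a; apply: cM => j d d0.
have [q qP] := seminorm_directed hp i j.
(* K is the loss in passing from the seminorm q, which controls both i and j,
   to the seminorm j of the part along M *)
pose K := 1 + (2 / e + 1) * p j E.
have e20 : 0 < 2 / e by rewrite divr_gt0.
have K1 : 1 <= K by rewrite lerDl mulr_ge0 // addr_ge0 // ltW.
have K0 : 0 < K by rewrite (lt_le_trans _ K1).
pose t := d / (2 * K).
have t0 : 0 < t by rewrite divr_gt0 // mulr_gt0.
have [U [b Mb] UT] := NT q t t0.
have [N small] := invS_eventually_lt t0; have [N' aN'] := aP t t0.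
have {}small := small _ (leq_maxl N N'); have {}aN' := aN' _ (leq_maxr N N').
have [Mk] := uP (maxn N N').
move: small aN' Mk; set k := maxn N N' => small ak Mk uk.
have ba : rnorm (b - a) <= (2 / e + 1) * t.
  rewrite -(subrK (c k) b) -addrA (le_trans (ler_rnormD _ _)) // mulrDl mul1r.
  apply: lerD; last exact: ltW.
  rewrite -(ler_pM2r e0) (le_trans (coef_close _ _ _ _ Mb Mk)) //.
  rewrite (_ : 2 / e * t * e = t + t); last by field; rewrite gt_eqF.
  apply: lerD; first by rewrite (le_trans (qP _).1) // ltW.
  by rewrite (le_trans (ltW uk)) // ltW.
exists (U - b *: E) => //.
rewrite (_ : U - b *: E - (T - a *: E) = (U - T) - (b - a) *: E); last first.
  by rewrite scalerBl !opprB [a *: E - T]addrC addrACA [- (b *: E) + _]addrC.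
rewrite (le_lt_trans (pD _ _ _)) // pN pZ.
rewrite (@le_lt_trans _ _ (t + (2 / e + 1) * t * p j E)) //.
  by rewrite lerD ?ler_wpM2r // (le_trans (qP _).2) // ltW.
rewrite (_ : t + _ = t * K); last by rewrite /K; ring.
rewrite (_ : t * K = d / 2); last by rewrite /t; field; rewrite gt_eqF.
by rewrite ltr_pdivrMr // mulr_natr mulr2n ltrDl.
Qed.

End Seminorms.

(** * Algebras generated by isometries with orthogonal ranges *)

Section GeneratedAlgebra.
Context {R : realType} {H : hilbertType R}.
Local Notation B := (bounded_op H).
Variables (n : nat) (S : 'I_n -> B).
Hypothesis isoS : isometries_with_orthogonal_ranges S.

Lemma row_left_inverse : exists t : 'I_n -> B,
  (forall i x y, inner (S i x) y = inner x (t i y)) /\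
  (forall i j, bmul (t i) (S j) = (if i == j then bone else 0)).
Proof.
case: isoS => iS oS.
have /choice[t tP] := fun i => isometry_adjoint (iS i).
exists t; split => [//|i j]; apply/val_inj/funext => x.
apply: inner_inj => z; rewrite -[LHS]tP; case: eqVneq => [->|ij].
  exact: isometry_inner.
rewrite oS //; exact/esym/linear0r.
Qed.

Section Dichotomy.
Variables (I : Type) (p : I -> B -> R).
Hypothesis hp : operator_seminorms p.
Variable M : closed_subalgebra B.
Hypothesis cM : seminorm_closed p (subalg_set M).
Hypothesis MS : forall i, subalg_set M (S i).
Hypothesis M_min : forall N : set B,
  unital_subalgebra N -> seminorm_closed p N -> (forall i, N (S i)) ->
  subalg_set M `<=` N.
Variable t : 'I_n -> B.
Hypothesis tS_adj : forall i x y, inner (S i x) y = inner x (t i y).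
Hypothesis tS : forall i j, bmul (t i) (S j) = (if i == j then bone else 0).

Let M1 : subalg_set M bone. Proof. by have [] := subalg_unital M. Qed.
Let MD x y : subalg_set M x -> subalg_set M y -> subalg_set M (x + y).
Proof. by have [_ + _ _] := subalg_unital M; exact. Qed.
Let MZ k x : subalg_set M x -> subalg_set M (k *: x).
Proof. by have [_ _ + _] := subalg_unital M; exact. Qed.
Let MM x y : subalg_set M x -> subalg_set M y -> subalg_set M (bmul x y).
Proof. by have [_ _ _ +] := subalg_unital M; exact. Qed.
Let M0 : subalg_set M 0.
Proof. by rewrite -(scale0r bone); exact: MZ. Qed.

(* the projection onto the orthogonal complement of all the ranges *)
Let Q : B := bone - \sum_i bmul (S i) (t i).

(** The right ideal of all sums of S i * A i with A i in M. Since t i recovers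
    A i, it is cut out by closed conditions. *)
Let J : set B := [set T | (forall i, subalg_set M (bmul (t i) T)) /\ bmul Q T = 0].

Let t_adj i : adjointable (t i).
Proof. by exists (S i) => x y; rewrite innerC -tS_adj -innerC. Qed.

Let Q_adj : adjointable Q.
Proof.
have opsum (F : 'I_n -> B) x : (\sum_i F i) x = \sum_i F i x.
  by elim/big_rec2 : _ => // i y1 y2 _ <-.
have QE x : Q x = x - \sum_i S i (t i x).
  by rewrite -(opsum (fun i => bmul (S i) (t i))).
have inner0l (z : H) : inner 0 z = 0 by exact: linear0l.
have inner0r (z : H) : inner z 0 = 0 by exact: linear0r.
have tS_inner i x y : inner x (S i y) = inner (t i x) y.
  by rewrite innerC tS_adj -innerC.
exists Q => x y; rewrite !QE innerBl innerBr.
rewrite (big_morph (inner x) (innerDr x) (inner0r x)).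
rewrite (big_morph _ (fun a b => innerDl a b y) (inner0l y)).
by congr (_ - _); apply: eq_bigr => i _; rewrite tS_adj tS_inner.
Qed.

Let cJ : seminorm_closed p J.
Proof.
move=> T JT; split => [i|].
  apply: (seminorm_closed_bmul hp (t_adj i) cM) => k e e0.
  by have [U [JU _] UT] := JT k e e0; exists U => //; exact: JU.
apply: (seminorm_closed_ker hp Q_adj) => k e e0.
by have [U [_ JU] UT] := JT k e e0; exists U.
Qed.

Let JB x y : J x -> J y -> J (x - y).
Proof.
move=> [x1 x2] [y1 y2]; split=> [i|]; last by rewrite bmulBr x2 y2 subrr.
by rewrite bmulBr -scaleN1r; apply: MD => //; apply: MZ.
Qed.

Let JZ k x : J x -> J (k *: x).
Proof.
by move=> [x1 x2]; split=> [i|]; rewrite bmulZr; [exact: MZ|rewrite x2 scaler0].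
Qed.

Let J0 : J 0. Proof. by split=> [i|]; rewrite bmulr0. Qed.

Let JD x y : J x -> J y -> J (x + y).
Proof. by move=> Jx Jy; rewrite -[y]opprK -[- y]sub0r; do 2?apply: JB. Qed.

Let JM x y : J x -> subalg_set M y -> J (bmul x y).
Proof.
move=> [x1 x2] My; split=> [i|]; first by rewrite bmulA; exact: MM.
by rewrite bmulA x2 bmul0r.
Qed.

Let JS j : J (S j).
Proof.
split=> [i|]; first by rewrite tS; case: ifP.
rewrite /Q bmulBl bmul1l bmul_suml (bigD1 j) //= big1 ?addr0 => [|i ij].
  by rewrite -bmulA tS eqxx bmul1r subrr.
by rewrite -bmulA tS (negbTE ij) bmulr0.
Qed.

(** If the right ideal J contains 1, then M contains every t i 1. *)
Lemma dichotomy : (forall i, subalg_set M (t i)) \/ ~ J bone.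
Proof.
have [[J1 _]|] := pselect (J bone); [left => i|by right].
by rewrite -[t i]bmul1r.
Qed.

(** The right-hand side is closed, and it is an algebra because J is a right
    ideal: x y - c d = (x - c) y + c (y - d). *)
Let codim1 : ~ J bone -> subalg_set M `<=` [set T | exists c, J (T - c *: bone)].
Proof.
move=> nJ; pose N := subalg_set M `&` [set T | exists c, J (T - c *: bone)].
suff MN : subalg_set M `<=` N by move=> T /MN[].
apply: M_min => [||i]; last by split=> //; exists 0; rewrite scale0r subr0.
- split=> [|x y [Mx [c xc]] [My [d yd]]|k x [Mx [c xc]]|x y [Mx [c xc]] [My [d yd]]].
  + by split=> //; exists 1; rewrite scale1r subrr.
  + split; first exact: MD.
    by exists (c + d); rewrite scalerDl opprD addrACA; exact: JD.
  + split; first exact: MZ.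
    by exists (k * c); rewrite -scalerA -scalerBr; exact: JZ.
  + split; first exact: MM.
    exists (c * d).
    rewrite (_ : _ - _ = bmul (x - c *: bone) y + c *: (y - d *: bone)).
      by apply: JD; [exact: JM|exact: JZ].
    by rewrite bmulBl bmulZl bmul1l scalerBr addrA subrK scalerA.
- apply: seminorm_closedI => //.
  exact: seminorm_closed_line.
Qed.

Variables i0 i1 : 'I_n.
Hypothesis i01 : i0 != i1.

Let ix (b : bool) : 'I_n := if b then i1 else i0.

Let ix_eq a b : (ix a == ix b) = (a == b).
Proof.
case: a; case: b; rewrite /= ?eqxx // ?(negbTE i01) //.
by rewrite eq_sym (negbTE i01).
Qed.

Let Msub (x : B) (Mx : subalg_set M x) : subalg_sort M :=
  SubalgSort (introT (in_subalgP M x) Mx).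

(** M is now the direct sum of the scalars and J. The projection onto the scalars
    is a bounded character phi, and x |-> t i (x - phi x) are the derivatives. *)
Lemma ltsr_no_unit : ~ J bone -> ltsr (subalg_sort M) = +oo%E.
Proof.
move=> nJ; have [i [e e0 eP]] := line_coef_bound hp JZ cJ nJ.
have [K0 K0P] := seminorm_bounded hp i.
have Mval (x : subalg_sort M) : subalg_set M (subalg_val x).
  exact/in_subalgP/subalg_valP.
have /choice[phi phiP] (x : subalg_sort M) : exists c, J (subalg_val x - c *: bone).
  by have [c] := codim1 nJ (Mval x); exists c.
have phi_uniq (x : subalg_sort M) c : J (subalg_val x - c *: bone) -> phi x = c.
  move=> xc; apply/eqP; rewrite -subr_eq0; apply/negPn/negP => c0; apply: nJ.
  rewrite -[bone](scalerK c0); apply: JZ; rewrite scalerBl.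
  have := JB xc (phiP x); rewrite opprB [_ + (_ - _)]addrC addrA subrK.
  by rewrite addrC.
have phi_linear k x y : phi (k *: x + y) = k * phi x + phi y.
  apply: phi_uniq; rewrite [subalg_val _](_ : _ = k *: subalg_val x + subalg_val y) //.
  rewrite scalerDl opprD addrACA -scalerA -scalerBr.
  by apply: JD => //; exact: JZ.
have phiM x y : phi (bmul x y) = phi x * phi y.
  apply: phi_uniq => /=.
  rewrite (_ : _ - _ = bmul (subalg_val x - phi x *: bone) (subalg_val y) +
    phi x *: (subalg_val y - phi y *: bone)).
    by apply: JD; [exact: JM|exact: JZ].
  by rewrite bmulBl bmulZl bmul1l scalerBr addrA subrK scalerA.
have phi1 : phi bone = 1.
  by apply: phi_uniq; rewrite scale1r subrr.
pose D (b : bool) (x : subalg_sort M) := Msub ((phiP x).1 (ix b)).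
pose s (b : bool) := Msub (MS (ix b)).
have phi_s b : phi (s b) = 0.
  by apply: phi_uniq; rewrite scale0r subr0; exact: JS.
have DE b x : subalg_val (D b x) = bmul (t (ix b)) (subalg_val x - phi x *: bone).
  by [].
pose K := `|K0| / e.
have phi_le x : rnorm (phi x) <= K * rnorm x.
  have := eP (phi x) _ (phiP x); rewrite addrC subrK => h.
  rewrite /K mulrAC ler_pdivlMr // (le_trans h) // (le_trans (K0P _)) //.
  by rewrite ler_wpM2r ?rnorm_ge0 // ler_norm.
pose L := (rnorm (t i0) + rnorm (t i1)) * (1 + K * rnorm (bone : B)).
have KL : 0 <= K by rewrite divr_ge0 // ltW.
have L0 : 0 <= L.
  by apply: mulr_ge0; apply: addr_ge0; rewrite ?ler01 ?rnorm_ge0 // mulr_ge0 ?rnorm_ge0.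
have D_le b x : rnorm (D b x) <= L * rnorm x.
  change (rnorm (subalg_val (D b x)) <= L * rnorm x); rewrite DE.
  rewrite (le_trans (ler_rnorm_bmul _ _)) // /L -mulrA.
  apply: ler_pM; rewrite ?rnorm_ge0 //.
    by case: b; rewrite /= ?lerDr ?lerDl rnorm_ge0.
  rewrite (le_trans (ler_rnormD _ _)) // rnormN rnormZ mulrDl mul1r lerD2l.
  by rewrite mulrAC ler_wpM2r ?rnorm_ge0.
apply: (@ltsr_fox R (subalg_sort M) phi D s (1 + K + L)) => //.
- move=> b k x y; apply: val_inj.
  rewrite [LHS]DE phi_linear.
  rewrite [RHS](_ : _ = k *: subalg_val (D b x) + subalg_val (D b y)) //.
  rewrite !DE [subalg_val _](_ : _ = k *: subalg_val x + subalg_val y) //.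
  by rewrite scalerDl opprD addrACA -scalerA -scalerBr bmulDr bmulZr.
- move=> b x y; apply: val_inj.
  rewrite [LHS]DE phiM [RHS](_ : _ = phi x *: subalg_val (D b y) +
    bmul (subalg_val (D b x)) (subalg_val y)) //.
  rewrite !DE -bmulA -bmulZr -bmulDr; congr (bmul _ _).
  by rewrite /= bmulBl bmulZl bmul1l [RHS]addrC scalerBr addrA subrK scalerA.
- move=> a b; apply: val_inj; rewrite [LHS]DE phi_s scale0r subr0 /= tS ix_eq.
  by case: ifP.
- by rewrite -addrA lerDl addr_ge0.
- move=> x; rewrite (le_trans (phi_le x)) // ler_wpM2r ?rnorm_ge0 //; lra.
- move=> b x; rewrite (le_trans (D_le b x)) // ler_wpM2r ?rnorm_ge0 //; lra.
Qed.

Lemma ltsr_generated : ltsr (subalg_sort M) = +oo%E.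
Proof.
have [Mt|] := dichotomy; last exact: ltsr_no_unit.
apply: (@ltsr_left_inverses _ _ M (@op_one_neq0 R H) (S i0) (S i1)
  (Msub (Mt i0)) (Msub (Mt i1))); rewrite /= tS ?eqxx //.
  by rewrite (negbTE i01).
by rewrite eq_sym (negbTE i01).
Qed.

Lemma rtsr_generated : rtsr (subalg_sort M) = +oo%E.
Proof.
apply: (@rtsr_left_inverses _ _ M (@op_one_neq0 R H) (Msub (MS i0))
  (Msub (MS i1)) (t i0) (t i1)); rewrite /= tS ?eqxx //.
  by rewrite (negbTE i01).
by rewrite eq_sym (negbTE i01).
Qed.

End Dichotomy.
End GeneratedAlgebra.

(** * The norm topology and the weak operator topology *)

Section Topologies.
Context {R : realType} {H : hilbertType R}.
Local Notation B := (bounded_op H).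

Definition norm_seminorm (_ : unit) (T : B) : R := rnorm T.

Lemma norm_operator_seminorms : operator_seminorms norm_seminorm.
Proof.
split=> [i S T|i k T|i j|i|T T0|A i _].
- exact: ler_rnormD.
- exact: rnormZ.
- by exists tt.
- by exists 1 => T; rewrite mul1r.
- exact: rnorm_eq0 (T0 tt).
- by exists tt, (rnorm A) => T; exact: ler_rnorm_bmul.
Qed.

Lemma norm_closedP (M : set B) : closed M <-> seminorm_closed norm_seminorm M.
Proof.
split=> cM T TM; apply: cM; last first.
  move=> [] e e0; have [|U [MU TU]] := TM (ball T e%:C).
    by apply: nbhsx_ballx; rewrite ltcR.
  by exists U => //; move: TU; rewrite -ball_normE /= -rnorm_lt rnormB.
move=> N /nbhs_ballP[e /= e0 eN].
have eE : (complex.Re e)%:C = e by exact/RRe_real/gtr0_real.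
have [|U MU UT] := TM tt (complex.Re e); first by rewrite -ltcR eE.
exists U; split=> //; apply: eN; rewrite -ball_normE /= -eE -rnorm_lt.
by rewrite rnormB.
Qed.

(** A list of pairs rather than one pair: the family has to be directed. *)
Definition wot_seminorm (l : seq (H * H)) (T : B) : R :=
  \sum_(z <- l) rnorm (inner (T z.1) z.2).

Lemma wot_operator_seminorms : operator_seminorms wot_seminorm.
Proof.
split=> [l S T|l k T|l l'|l|T T0|A l [A' AA']]; rewrite /wot_seminorm.
- rewrite -big_split ler_sum // => z _.
  by rewrite (_ : (S + T) z.1 = S z.1 + T z.1) // innerDl ler_rnormD.
- rewrite mulr_sumr; apply: eq_bigr => z _.
  by rewrite (_ : (k *: T) z.1 = k *: T z.1) // innerZl rnormM.
- exists (l ++ l') => T; rewrite big_cat /=.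
  by rewrite lerDl lerDr !sumr_ge0 // => z _; exact: rnorm_ge0.
- exists (\sum_(z <- l) rnorm z.1 * rnorm z.2) => T; rewrite mulr_suml ler_sum // => z _.
  rewrite (le_trans (rnorm_CauchySchwarz _ _)) // mulrAC ler_wpM2r ?rnorm_ge0 //.
  by rewrite mulrC rnorm_le rmorphM /= !rnormE ler_norm_op.
- apply/val_inj/funext => x; apply: inner_inj => y; rewrite innerC.
  have := T0 [:: (x, y)]; rewrite /wot_seminorm big_seq1 => /rnorm_eq0 ->.
  by rewrite rmorph0; exact/esym/linear0r.
- exists [seq (z.1, A' z.2) | z <- l], 1 => T; rewrite mul1r big_map.
  by apply: ler_sum => z _ /=; rewrite AA'.
Qed.

Lemma wot_nbhs (T : B) (l : seq (H * H)) (e : R) : 0 < e ->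
  nbhs (T : wot) [set U | wot_seminorm l (U - T) < e].
Proof.
elim: l e => [|z l IH] e e0.
  by apply: filterS filterT => U _ /=; rewrite /wot_seminorm big_nil.
have e20 : 0 < e / 2 by rewrite divr_gt0.
have ez : nbhs (T : wot) [set U : B | rnorm (inner ((U - T) z.1) z.2) < e / 2].
  have FF : Filter (nbhs (T : wot)) by exact: nbhs_filter.
  have FT : wot_eval @ (T : wot) --> wot_eval T by exact: initial_continuous.
  have /cvgrPdist_lt/(_ (e / 2)%:C) :=
    (pointwise_cvgP _ (fmap_filter _ FF)).1 FT z.
  rewrite ltcR => /(_ e20) near_T.
  have : nbhs (T : wot) [set U | `|wot_eval T z - wot_eval U z| < (e / 2)%:C].
    exact: near_T.
  apply: filterS => U /=; rewrite /wot_eval.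
  by rewrite -rnorm_lt rnormB -innerBl.
apply: filterS (filterI ez (IH _ e20)) => U /= [Uz Ul].
by rewrite /wot_seminorm big_cons [e]splitr ltrD.
Qed.

Lemma wot_closedP (M : set B) :
  @closed (wot (H := H)) M <-> seminorm_closed wot_seminorm M.
Proof.
split=> cM T TM; apply: cM; last first.
  by move=> l e e0; have [U [MU TU]] := TM _ (wot_nbhs T l e0); exists U.
have [_ _ hdir _ _ _] := wot_operator_seminorms.
(* the filter of the seminorm neighbourhoods of T, traced on M *)
pose F : set_system B := filter_from [set d : seq (H * H) * R | 0 < d.2]
  (fun d => M `&` [set U | wot_seminorm d.1 (U - T) < d.2]).
have FF : Filter F.
  apply: filter_from_filter; first by exists ([::], 1) => /=.
  move=> [l e] [l' e'] /= e0 e'0; have [k kP] := hdir l l'.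
  exists (k, Num.min e e') => /=; first by rewrite lt_min e0.
  move=> U [MU]; rewrite /= lt_min => /andP[Ue Ue'].
  by split; split=> //=; rewrite (le_lt_trans _ Ue, le_lt_trans _ Ue') //;
    case: (kP (U - T)).
have FT : F --> (T : wot).
  move=> N [_ /= [[W oW <-] WT]] /filterS; apply.
  suff : wot_eval @ F --> wot_eval T by apply; exact: open_nbhs_nbhs.
  apply/pointwise_cvgP => -[x y]; apply/cvgrPdist_lt => e e0.
  have eE : (complex.Re e)%:C = e by exact/RRe_real/gtr0_real.
  exists ([:: (x, y)], complex.Re e) => /=; first by rewrite -ltcR eE.
  move=> U [_]; rewrite /= /wot_seminorm big_seq1 /= => UT.
  by rewrite -eE -rnorm_lt rnormB /wot_eval -innerBl.
move=> N /FT [[l e] /= e0 eN]; have [U MU UT] := TM l e e0.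
by exists U; split=> //; exact: eN.
Qed.

End Topologies.

(** * The stable ranks of the two generated algebras *)

Lemma generated_stable_rank (R : realType) (n : nat) (hn : (2 <= n)%N)
    (H : hilbertType R) (S : 'I_n -> bounded_op H) (cl : set (set (bounded_op H)))
    (I : Type) (p : I -> bounded_op H -> R) (M : closed_subalgebra (bounded_op H)) :
  operator_seminorms p -> (forall N, cl N <-> seminorm_closed p N) ->
  subalg_set M = unital_subalgebra_generated cl (range S) ->
  cl (unital_subalgebra_generated cl (range S)) ->
  isometries_with_orthogonal_ranges S ->
  ltsr (subalg_sort M) = +oo%E /\ rtsr (subalg_sort M) = +oo%E.
Proof.
move=> hp clP ME cM isoS; have [t [t_adj tS]] := row_left_inverse isoS.
have MS i : subalg_set M (S i).
  by rewrite ME => N [_]; apply; exists i.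
have i01 : Ordinal (ltnW hn) != Ordinal hn by [].
split; last exact: (rtsr_generated MS tS i01).
apply: (ltsr_generated hp _ MS _ t_adj tS i01).
  by rewrite ME; exact/clP.
move=> N N1 N2 N3; rewrite ME => T; apply.
by split; [split=> //; exact/clP|move=> _ [i _ <-]].
Qed.

Theorem theorem3p1 (R : realType) (n : nat) (hn : (2 <= n)%N) :
  (forall (H : hilbertType R) (S : 'I_n -> bounded_op H),
     isometries_with_orthogonal_ranges S ->
     ltsr (noncommutative_disc_algebra S) = +oo%E /\
     rtsr (noncommutative_disc_algebra S) = +oo%E) /\
  (forall (H : hilbertType R) (S : 'I_n -> bounded_op H),
     isometries_with_orthogonal_ranges S ->
     ltsr (free_semigroup_algebra S) = +oo%E /\
     rtsr (free_semigroup_algebra S) = +oo%E).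
Proof.
split=> H S isoS.
- apply: (generated_stable_rank hn (@norm_operator_seminorms R H)
    (@norm_closedP R H)) => //.
  exact: norm_generated_closed.
- apply: (generated_stable_rank hn (@wot_operator_seminorms R H)
    (@wot_closedP R H)) => //.
  by apply: closed_bigI => M [[]].
Qed.
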